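(* For every $k\in\mathbb{N}$, every $x\in\mathbb{C}$ with $|x|\le 1$ and every real $b\in(0,1]$, $$ \begin{aligned} & \cos (b\pi) \bigg\{ \sum_{m\geq 1,\, n\geq 0}\frac{x^n}{m(m+n+b)^{k+1}}-\sum_{m\geq 1,\, n\geq 0}\frac{x^{m+n}}{m(m+n+b)^{k+1}}\\ & \quad +\sum_{\nu=2}^{k+1} \sum_{m\geq 1,\, n\geq 0}\frac{x^n}{(n+b)^{k+2-\nu}(m+n+b)^\nu}-\sum_{m\geq 1,\, n\geq 0}\frac{x^{m+n}}{(n+b)(m+n+b)^{k+1}}\\ & \quad + \sum_{m> b,\, n\geq 0}\frac{x^n}{(m-b)(m+n)^{k+1}}+\sum_{\nu=2}^{k+1}\sum_{m> b,\, n\geq 0}\frac{x^n}{(n+b)^{k+2-\nu}(m+n)^\nu}\bigg\} \\ & -\frac{\sin (b\pi)}{\pi} \bigg\{ \sum_{m\geq 1,\, n\geq 0}\frac{x^n}{m(m+n+b)^{k+2}}-\sum_{m\geq 1,\, n\geq 0}\frac{x^{m+n}}{m(m+n+b)^{k+2}}\\ & \quad +\sum_{\nu=1}^{k} \sum_{m\geq 1,\, n\geq 0}\frac{x^n}{(n+b)^\nu(m+n+b)^{k+3-\nu}}-\sum_{m\geq 1,\, n\geq 0}\frac{x^{m+n}}{(n+b)(m+n+b)^{k+2}}\\ & \quad -\sum_{m\geq 1,\, n\geq 0}\frac{x^{m+n}}{(n+b)^2(m+n+b)^{k+1}}-\sum_{m> b,\, n\geq 0}\frac{x^n}{(m-b)^2(m+n)^{k+1}}\\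 & \quad-k\sum_{m> b,\, n\geq 0}\frac{x^n}{(m-b)(m+n)^{k+2}}-\sum_{\nu=1}^{k}\nu\sum_{m> b,\, n\geq 0}\frac{x^n}{(n+b)^{k+1-\nu}(m+n)^{\nu+2}}\bigg\}\\ & =\pi \sin (b\pi) \sum_{n\geq 0} \frac{x^n}{(n+b)^{k+1}}+2\cos (b\pi) \sum_{n\geq 0} \frac{x^n}{(n+b)^{k+2}} -\frac{2\sin (b\pi)}{\pi}\sum_{n\geq 0} \frac{x^n}{(n+b)^{k+3}}. \end{aligned} $$
   Context: $\mathbb{N}$ is the set of positive integers. All summation variables $m,n$ are integers; the condition $m>b$ means $m$ runs over all integers strictly greater than $b$ (so $m\ge 1$ if $0<b<1$ and $m\ge 2$ if $b=1$). The convention $x^0=1$ is used (also for $x=0$). All double series occurring converge absolutely. *)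

(* Defs.v *)
From mathcomp Require Import all_boot all_order all_algebra.
From mathcomp Require Import complex.
From mathcomp Require Import all_classical all_reals all_analysis.
From mathcomp Require Import summability.

Set Implicit Arguments.
Unset Strict Implicit.
Unset Printing Implicit Defensive.

Import Order.TTheory GRing.Theory Num.Theory.
Import numFieldNormedType.Exports.

Local Open Scope ring_scope.
Local Open Scope complex_scope.

(* Double series are unordered sums: the limit of the partial sums over finite
   subsets of nat * nat.  In R[i] this limit exists exactly when the series
   converges absolutely, so no order of summation enters.  P restricts m. *)
Definition dsum (R : realType) (P : pred nat) (F : nat -> nat -> R[i]) : R[i] :=
  summability.sum (R := (R[i] : numFieldType)^o)
    (fun p : nat * nat => if P p.1 then F p.1 p.2 else 0).

Definition csum (R : realType) (f : nat -> R[i]) : R[i] :=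
  limn (series (f : nat -> (R[i] : numFieldType)^o)).

Notation "\dsum_ ( m , n | P ) F" := (dsum (fun m => P%B) (fun m n => F))
  (at level 34, F at level 41, m name, n name,
   format "'[' \dsum_ ( m ,  n  |  P ) '/  '  F ']'") : ring_scope.

Notation "\csum_ n F" := (csum (fun n => F))
  (at level 34, F at level 41, n name,
   format "'[' \csum_ n '/  '  F ']'") : ring_scope.

(* Main.v *)
(* Fix n and put a = n + b.  The coefficient of x^n in each double series is a sum
   over m of rational functions of m, and the sums over nu supply the missing terms
   of partial fraction expansions with respect to u and v = u + a, where u = m or
   u = m - b.  What is left of them are the terms 1/u - 1/v, 1/u^2 and 1/v^2, and
   the identity between coefficients reduces to
     sum_(j >= 0) (1/(j+b) - 1/(j+1-b)) = pi cot (pi b),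
     sum_(j >= 0) (1/(j+b)^2 + 1/(j+1-b)^2) = pi^2 / sin^2 (pi b)
   when b < 1, while for b = 1 the sine vanishes and the cosine part telescopes.
   The second expansion comes from iterating
     1/sin^2 t = (1/sin^2 (t/2) + 1/sin^2 ((pi-t)/2)) / 4
   and the bounds 1/t^2 <= 1/sin^2 t <= 1/t^2 + 1 on ]0, pi/2]; the first one
   follows from it by the mean value theorem, since both sides vanish at b = 1/2
   and the derivative of their difference is the tail of the second expansion. *)

Require Import Defs.
From mathcomp Require Import all_boot all_order all_algebra.
From mathcomp Require Import zify ring lra.
From mathcomp Require Import finmap.
From mathcomp Require Import complex.
From mathcomp Require Import all_classical all_reals all_analysis.
From mathcomp Require Import summability.

Set Implicit Arguments.
Unset Strict Implicit.
Unset Printing Implicit Defensive.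

Import Order.TTheory GRing.Theory Num.Theory.
Import numFieldNormedType.Exports.

Local Open Scope ring_scope.
Local Open Scope complex_scope.

(** * Partial fraction expansions of cot and 1/sin^2 *)

Lemma is_derive_nondecreasing (R : realType) (f df : R -> R) (a b : R) :
  (forall x : R, is_derive x 1 f (df x)) -> (forall x, a <= x <= b -> 0 <= df x) ->
  a <= b -> f a <= f b.
Proof.
move=> fdf df0 ab; have fc : continuous f.
  by move=> x; apply/differentiable_continuous/derivable1_diffP; case: (fdf x).
have [|c] := @MVT_segment R f df a b ab (fun x _ => fdf x).
  exact: continuous_subspaceT.
rewrite in_itv /= => cab e; rewrite -subr_ge0 e mulr_ge0 ?subr_ge0 //.
exact: df0.
Qed.

Lemma sin_le_id (R : realType) (t : R) : 0 <= t -> sin t <= t.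
Proof.
move=> t0; rewrite -subr_ge0.
rewrite -[leLHS](_ : 0 - sin 0 = 0); last by rewrite sin0 subr0.
apply: (@is_derive_nondecreasing _ (fun t => t - sin t) (fun t => 1 - cos t)) => //.
Qed.

Lemma mul_cos_le_sin (R : realType) (t : R) : 0 <= t <= pi -> t * cos t <= sin t.
Proof.
move=> /andP[t0 tpi]; rewrite -subr_ge0.
rewrite -[leLHS](_ : sin 0 - 0 * cos 0 = 0); last by rewrite sin0 mul0r subr0.
apply: (@is_derive_nondecreasing _ (fun t => sin t - t * cos t) (fun t => t * sin t)) => // x.
  by apply: is_derive_eq; rewrite /GRing.scale /=; ring.
by move=> /andP[x0 xt]; rewrite mulr_ge0 // sin_ge0_pi // x0 (le_trans xt).
Qed.

(** The lower bound comes from [sin t <= t]. For the upper one, 1/sin^2 is cot^2 + 1, and cot t <=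
    1/t is [mul_cos_le_sin]. Up to pi/2 the cosine is nonnegative, so squaring keeps the order. *)
Lemma csc2_bounds (R : realType) (t : R) : 0 < t <= pi / 2 ->
  (t ^+ 2)^-1 <= (sin t ^+ 2)^-1 <= (t ^+ 2)^-1 + 1.
Proof.
move=> /andP[t0 tpi]; have pi0 := pi_gt0 R.
have s0 : 0 < sin t by apply: sin_gt0_pi; lra.
have c0 : 0 <= cos t by apply: cos_ge0_pihalf; lra.
apply/andP; split.
  rewrite lef_pV2 ?posrE ?exprn_gt0 // lerXn2r ?nnegrE ?(ltW t0) ?(ltW s0) //.
  exact/sin_le_id/ltW.
have h : t * cos t <= sin t by apply: mul_cos_le_sin; lra.
have -> : (sin t ^+ 2)^-1 = (cos t / sin t) ^+ 2 + 1.
  have sn : sin t ^+ 2 != 0 by rewrite expf_neq0 // gt_eqF.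
  by rewrite -[in RHS](divff sn) expr_div_n -mulrDl cos2Dsin2 mul1r.
rewrite lerD2r -exprVn lerXn2r ?nnegrE ?invr_ge0 ?divr_ge0 ?(ltW t0) ?(ltW s0) //.
by rewrite ler_pdivrMr // mulrC ler_pdivlMr // mulrC.
Qed.

(** With s and c the sine and cosine of t/2, sin ((pi - t)/2) = c, so the bracket is 1/s^2 + 1/c^2 =
    1/(s c)^2, while sin t = 2 s c. *)
Lemma csc2_half (R : realType) (t : R) : 0 < t < pi ->
  (sin t ^+ 2)^-1 = 4^-1 * ((sin (t / 2) ^+ 2)^-1 + (sin ((pi - t) / 2) ^+ 2)^-1).
Proof.
move=> /andP[t0 tpi].
have -> : (pi - t) / 2 = - (t / 2 - pi / 2) by field.
rewrite sinN sinBpihalf opprK.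
have -> : sin t = 2 * (sin (t / 2) * cos (t / 2)).
  have {1}-> : t = (t / 2) *+ 2 by rewrite mulr2n; field.
  by rewrite sin_mulr2n [cos _ * _]mulrC mulr_natl.
have s0 : sin (t / 2) != 0 by rewrite gt_eqF //; apply: sin_gt0_pi; lra.
have c0 : cos (t / 2) != 0 by rewrite gt_eqF //; apply: cos_gt0_pihalf; lra.
have := cos2Dsin2 (t / 2).
move: (sin _) (cos _) s0 c0 => s c s0 c0 e.
have -> : (s ^+ 2)^-1 + (c ^+ 2)^-1 = (c ^+ 2 + s ^+ 2) / (s ^+ 2 * c ^+ 2).
  by field; rewrite s0 c0.
by rewrite e; field; rewrite s0 c0.
Qed.

(** This is [csc2_half] iterated n+1 times. All resulting angles lie in ]0, pi/2[, where
    [csc2_bounds] applies. *)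
Lemma csc2_dyadic (R : realType) (b : R) (n : nat) : 0 < b < 1 ->
  (sin (b * pi) ^+ 2)^-1 = (4 ^+ n.+1)^-1 *
    \sum_(k < 2 ^ n) ((sin ((k%:R + b) * pi / 2 ^+ n.+1) ^+ 2)^-1 +
                      (sin ((k%:R + 1 - b) * pi / 2 ^+ n.+1) ^+ 2)^-1).
Proof.
move=> /andP[b0 b1]; have pi0 := pi_gt0 R; elim: n => [|n ->].
  rewrite big_ord1 /= !expr1 add0r csc2_half //; last first.
    by rewrite mulr_gt0 //= gtr_pMl.
  by congr (_ * ((sin _ ^+ 2)^-1 + (sin _ ^+ 2)^-1)); field.
rewrite [in RHS]exprS invfM mulrAC [in RHS]mulrC; congr (_ * _).
pose f (c : R) (k : nat) := (sin ((k%:R + c) * pi / 2 ^+ n.+2) ^+ 2)^-1.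
have hpow : (2 : R) ^+ n = (2 ^ n)%N%:R by rewrite natrX.
(* Halving the angle of index k yields the indices k and 2^(n+1)-1-k, the latter
   with c replaced by 1 - c. *)
have step (c : R) (k : nat) : 0 < c < 1 -> (k < 2 ^ n)%N ->
    (sin ((k%:R + c) * pi / 2 ^+ n.+1) ^+ 2)^-1 =
    4^-1 * (f c k + f (1 - c) ((2 ^ n) + (2 ^ n - k.+1))%N).
  move=> /andP[c0 c1] kn.
  have k1 : k%:R + 1 <= (2 ^+ n : R) by rewrite hpow natr1 ler_nat.
  have p0 : 0 < (2 ^+ n : R) by rewrite exprn_gt0.
  rewrite csc2_half /f; last first.
    apply/andP; split; first by rewrite !(mulr_gt0, invr_gt0, exprn_gt0) // ltr_wpDl.
    rewrite ltr_pdivrMr ?exprn_gt0 // mulrC ltr_pM2l //.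
    by rewrite exprS; lra.
  congr (_ * ((sin _ ^+ 2)^-1 + (sin _ ^+ 2)^-1)).
    by rewrite [2 ^+ n.+2]exprSr invfM mulrA.
  rewrite natrD natrB // -hpow -natr1 !exprS; field.
  by rewrite gt_eqF.
under eq_bigr => k _.
  rewrite -addrA step; [|lra|by []].
  rewrite step; [|lra|by []].
  rewrite -mulrDr.
  over.
rewrite -mulr_sumr; congr (_ * _).
have -> : \sum_(k < 2 ^ n.+1) ((sin ((k%:R + b) * pi / 2 ^+ n.+2) ^+ 2)^-1 +
         (sin ((k%:R + 1 - b) * pi / 2 ^+ n.+2) ^+ 2)^-1) =
       \sum_(k < 2 ^ n + 2 ^ n) (f b k + f (1 - b) k).
  by rewrite expnS mul2n -addnn; apply: eq_bigr => k _; rewrite /f addrA.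
rewrite big_split_ord /=.
(* The upper half of the index range is run through backwards, which is the order in which [step]
   produces it. *)
rewrite -(big_mkord xpredT (fun k => f b (2 ^ n + k)%N + f (1 - b) (2 ^ n + k)%N)).
rewrite big_nat_rev /= big_mkord -big_split; apply: eq_bigr => k _ /=.
by rewrite add0n subKr; ring.
Qed.

(** By [csc2_bounds] scaled by pi^2 / 4^(n+1), each of the 2^(n+1) terms exceeds its rational
    counterpart by at most that factor; in total this makes pi^2 / 2^(n+1). *)
Lemma csc2_dyadic_bounds (R : realType) (b : R) (n : nat) : 0 < b < 1 ->
  \sum_(k < 2 ^ n) (((k%:R + b) ^+ 2)^-1 + ((k%:R + 1 - b) ^+ 2)^-1)
    <= (pi / sin (b * pi)) ^+ 2 <=
  \sum_(k < 2 ^ n) (((k%:R + b) ^+ 2)^-1 + ((k%:R + 1 - b) ^+ 2)^-1) + pi ^+ 2 / 2 ^+ n.+1.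
Proof.
move=> b01; have pi0 := pi_gt0 R.
have q0 : 0 < (2 ^+ n : R) by rewrite exprn_gt0.
have term (c : R) (k : 'I_(2 ^ n)) : 0 < c < 1 ->
    ((k%:R + c) ^+ 2)^-1 <= pi ^+ 2 / 4 ^+ n.+1 / sin ((k%:R + c) * pi / 2 ^+ n.+1) ^+ 2
       <= ((k%:R + c) ^+ 2)^-1 + pi ^+ 2 / 4 ^+ n.+1.
  move=> /andP[c0 c1].
  have k1 : k%:R + 1 <= (2 ^+ n : R) by rewrite -natrX natr1 ler_nat.
  have kc0 : 0 < k%:R + c by rewrite ltr_wpDl.
  have w0 : 0 < pi ^+ 2 / 4 ^+ n.+1 :> R by rewrite divr_gt0 ?exprn_gt0.
  have /csc2_bounds : 0 < (k%:R + c) * pi / 2 ^+ n.+1 <= pi / 2.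
    apply/andP; split; first by rewrite !(mulr_gt0, invr_gt0, exprn_gt0).
    rewrite ler_pdivrMr ?exprn_gt0 // exprS mulrA divfK // mulrC ler_pM2l //.
    by lra.
  have -> : (((k%:R + c) * pi / 2 ^+ n.+1) ^+ 2)^-1 =
            (pi ^+ 2 / 4 ^+ n.+1)^-1 * ((k%:R + c) ^+ 2)^-1.
    have -> : (4 : R) = 2 ^+ 2 by ring.
    by rewrite -exprM mulnC exprM !exprMn !exprVn !invfM invrK; ring.
  set W := pi ^+ 2 / _ in w0 *; move=> /andP[h1 h2].
  apply/andP; split; first by rewrite -ler_pdivrMl.
  by rewrite -ler_pdivlMl // [leRHS]mulrDr mulVf ?gt_eqF.
have -> : (pi / sin (b * pi)) ^+ 2 = \sum_(k < 2 ^ n)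
    (pi ^+ 2 / 4 ^+ n.+1 / sin ((k%:R + b) * pi / 2 ^+ n.+1) ^+ 2 +
     pi ^+ 2 / 4 ^+ n.+1 / sin ((k%:R + 1 - b) * pi / 2 ^+ n.+1) ^+ 2).
  rewrite expr_div_n (csc2_dyadic n b01) mulrA mulr_sumr.
  by apply: eq_bigr => k _; rewrite mulrDr.
have term' (k : 'I_(2 ^ n)) := term (1 - b) k ltac:(lra).
apply/andP; split.
  apply: ler_sum => k _; rewrite lerD //; first by have /andP[] := term b k b01.
  by have /andP[] := term' k; rewrite addrA.
have -> : pi ^+ 2 / 2 ^+ n.+1 = \sum_(k < 2 ^ n) (pi ^+ 2 / 4 ^+ n.+1 *+ 2) :> R.
  rewrite sumr_const card_ord -[RHS]mulr_natr natrX.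
  have -> : 4 ^+ n.+1 = 4 * (2 ^+ n) ^+ 2 :> R.
    by rewrite exprS -exprM mulnC exprM; congr (_ * _ ^+ n); ring.
  by rewrite (exprS 2 n); field; rewrite gt_eqF.
rewrite -big_split; apply: ler_sum => k _ /=.
rewrite mulr2n [leRHS]addrACA lerD //; first by have /andP[] := term b k b01.
by have /andP[] := term' k; rewrite addrA.
Qed.

(** Monotonicity in the number of terms carries the dyadic bounds over to all partial sums. The rate
    is uniform in b, as the mean value argument of [cot_series] requires. *)
Lemma csc2_partial_sum_bounds (R : realType) (b : R) (M : nat) : 0 < b < 1 ->
  0 <= (pi / sin (b * pi)) ^+ 2 -
       \sum_(k < M.+1) (((k%:R + b) ^+ 2)^-1 + ((k%:R + 1 - b) ^+ 2)^-1)
    <= pi ^+ 2 / M.+1%:R.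
Proof.
move=> b01; set u := fun k : nat => ((k%:R + b) ^+ 2)^-1 + ((k%:R + 1 - b) ^+ 2)^-1.
have u0 k : 0 <= u k by rewrite addr_ge0 // invr_ge0 sqr_ge0.
have mono m n : (m <= n)%N -> \sum_(k < m) u k <= \sum_(k < n) u k.
  move=> mn; rewrite -!(big_mkord xpredT u) (big_cat_nat _ mn) //= lerDl.
  exact: sumr_ge0.
apply/andP; split.
  have /andP[h _] := csc2_dyadic_bounds M.+1 b01; rewrite subr_ge0 (le_trans _ h) //.
  by apply: mono; apply: ltnW; apply: ltn_expl.
(* 2^n is the largest power of two not above M+1, so the dyadic error pi^2 / 2^(n+1) is at most pi^2
   / (M+1). *)
set n := trunc_log 2 M.+1.
have /andP[h1 h2] : (2 ^ n <= M.+1 < 2 ^ n.+1)%N by apply: trunc_log_bounds.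
have /andP[_ h] := csc2_dyadic_bounds n b01; rewrite lerBlDl (le_trans h) // lerD ?mono //.
rewrite ler_pM2l ?exprn_gt0 ?pi_gt0 //.
by rewrite lef_pV2 ?posrE ?exprn_gt0 // -natrX ler_nat ltnW.
Qed.

Lemma cvg_of_rate (R : realType) (u : nat -> R) (l C : R) :
  (forall M, `|l - u M.+1| <= C / M.+1%:R) -> (u @ \oo --> l)%classic.
Proof.
move=> h; rewrite -cvg_shiftS; apply/cvgrPdist_le => e e0.
have /cvgr0_norm_le : ((fun M => C * harmonic M) @ \oo --> (0 : R))%classic.
  rewrite -(mulr0 C); apply: cvgMl_tmp; exact: cvg_harmonic.
move=> /(_ _ e0); apply: filterS => M; apply: le_trans.
apply: le_trans (h M) _; exact: ler_norm.
Qed.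

Lemma csc2_series (R : realType) (b : R) : 0 < b < 1 ->
  ((fun M => \sum_(k < M) (((k%:R + b) ^+ 2)^-1 + ((k%:R + 1 - b) ^+ 2)^-1)) @ \oo
    --> (pi / sin (b * pi)) ^+ 2)%classic.
Proof.
move=> b01; apply: (@cvg_of_rate _ _ _ (pi ^+ 2)) => M.
by have /andP[h0 h1] := csc2_partial_sum_bounds M b01; rewrite ger0_norm.
Qed.

(** The derivative of - pi cot (pi x) is (pi / sin (pi x))^2, and each pair of fractions contributes
    minus one pair of squares. The result is the remainder estimated in
    [csc2_partial_sum_bounds]. *)
Lemma is_derive_cot_defect (R : realType) (M : nat) (x : R) : 0 < x < 1 ->
  is_derive x 1 (fun x : R => \sum_(k < M) ((k%:R + x)^-1 - (k%:R + 1 - x)^-1)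
                            - pi * cos (x * pi) / sin (x * pi))
    ((pi / sin (x * pi)) ^+ 2 -
     \sum_(k < M) (((k%:R + x) ^+ 2)^-1 + ((k%:R + 1 - x) ^+ 2)^-1)).
Proof.
move=> /andP[x0 x1]; elim: M => [|M IH].
  have s0 : sin (x * pi) != 0.
    by rewrite gt_eqF // sin_gt0_pi // mulr_gt0 ?pi_gt0 //= gtr_pMl ?pi_gt0.
  rewrite big_ord0 subr0.
  rewrite [X in is_derive _ _ X _](_ : _ =
    fun x => - (pi * cos (x * pi) * (sin (x * pi))^-1)); last first.
    by apply/funext => y; rewrite big_ord0 add0r.
  have dx : is_derive x (1 : R) (fun x => x * pi) pi.
    by apply: is_derive_eq; rewrite /GRing.scale /=; ring.
  have ds : is_derive x (1 : R) (fun x => (sin (x * pi))^-1)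
      (- (sin (x * pi)) ^- 2 *: (pi * cos (x * pi))).
    apply: is_deriveV => //; apply: is_derive_eq.
    by rewrite /GRing.scale /=; ring.
  apply: is_derive_eq.
  rewrite /GRing.scale /= expr_div_n.
  have := cos2Dsin2 (x * pi); move: (sin _) (cos _) s0 => s c s0 e.
  rewrite -[pi ^+ 2]mulr1 -e; field; exact: s0.
have dM : is_derive x 1 (fun x : R => (M%:R + x)^-1 - (M%:R + 1 - x)^-1)
   (- (((M%:R + x) ^+ 2)^-1 + ((M%:R + 1 - x) ^+ 2)^-1)).
  have n1 : M%:R + x != 0 by rewrite gt_eqF // ltr_wpDl.
  have n2 : M%:R + 1 - x != 0 by rewrite gt_eqF // -addrA ltr_wpDl // subr_gt0.
  have d1 := @is_deriveV _ (fun x : R => M%:R + x) x _ _ n1 _.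
  have d2 := @is_deriveV _ (fun x : R => M%:R + 1 - x) x _ _ n2 _.
  apply: is_derive_eq.
  by rewrite /GRing.scale /=; ring.
rewrite big_ord_recr /= opprD addrA -[_ + _]addrC.
rewrite (_ : (fun x => _) = (fun x : R =>
    (\sum_(k < M) ((k%:R + x)^-1 - (k%:R + 1 - x)^-1) - pi * cos (x * pi) / sin (x * pi))
    + ((M%:R + x)^-1 - (M%:R + 1 - x)^-1))).
  apply: is_derive_eq.
  by rewrite opprD addrC; ring.
by apply/funext => y; rewrite big_ord_recr /= addrAC.
Qed.

Lemma cot_series (R : realType) (b : R) : 0 < b < 1 ->
  ((fun M => \sum_(k < M) ((k%:R + b)^-1 - (k%:R + 1 - b)^-1)) @ \oo
    --> pi * cos (b * pi) / sin (b * pi))%classic.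
Proof.
move=> b01; apply: (@cvg_of_rate _ _ _ (pi ^+ 2)) => M.
set g := fun x : R => \sum_(k < M.+1) ((k%:R + x)^-1 - (k%:R + 1 - x)^-1)
                            - pi * cos (x * pi) / sin (x * pi).
rewrite distrC -[X in `|X|]/(g b).
(* At 1/2 the cosine vanishes, and so does each summand because k + 1/2 = k + 1 - 1/2. *)
have g0 : g 2^-1 = 0.
  rewrite /g [2^-1 * pi]mulrC cos_pihalf mulr0 mul0r subr0 big1 // => k _.
  by apply/eqP; rewrite subr_eq0; apply/eqP; congr (_^-1); field.
(* The mean value theorem on [x, y]; it is used with 1/2 as the right or the left end, according to
   the position of b. *)
have key x y : 0 < x -> x <= y -> y < 1 -> `|g y - g x| <= pi ^+ 2 / M.+1%:R * (y - x).
  move=> x0 xy y1.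
  have dg z : z \in `[x, y] -> is_derive z 1 g ((pi / sin (z * pi)) ^+ 2 -
     \sum_(k < M.+1) (((k%:R + z) ^+ 2)^-1 + ((k%:R + 1 - z) ^+ 2)^-1)).
    by rewrite in_itv /= => /andP[xz zy]; apply: is_derive_cot_defect; lra.
  have [|c] := MVT_segment xy (df := fun z => _) (fun z zi => dg z (subset_itv_oo_cc zi)).
    by apply: derivable_within_continuous => z /dg [].
  rewrite in_itv /= => /andP[xc cy] ->; rewrite normrM (ger0_norm (x := y - x)) ?subr_ge0 //.
  rewrite ler_wpM2r ?subr_ge0 //.
  have /andP[h0 h1] : 0 <= _ <= _ := csc2_partial_sum_bounds M (b := c) ltac:(lra).
  by rewrite ger0_norm.
have C0 : 0 <= pi ^+ 2 / M.+1%:R :> R by rewrite divr_ge0 ?sqr_ge0.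
have [b0 b1] := andP b01.
have [h|h] := leP b 2^-1.
  have := key b 2^-1 b0 h ltac:(lra); rewrite g0 sub0r normrN => /le_trans; apply.
  by rewrite ler_piMr //; lra.
have := key 2^-1 b ltac:(lra) (ltW h) b1; rewrite g0 subr0 => /le_trans; apply.
by rewrite ler_piMr //; lra.
Qed.

(** * Unordered sums *)

#[local] Existing Instance totally_filter.

(** Existence of the unordered sum is bundled with its value, whereas [dsum] is a bare limit that is
    meaningful only once convergence is known. *)
Definition has_sum (I : choiceType) (K : numFieldType) (F : I -> K) (D : K) : Prop :=
  (partial_sum F @ totally --> (D : K^o))%classic.

Lemma partial_sumE (I : choiceType) (V : zmodType) (F : I -> V) (A : {fset I}) :
  partial_sum F A = \sum_(i <- A) F i.
Proof. by rewrite /partial_sum big_seq_fsetE. Qed.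

Lemma has_sumP (I : choiceType) (K : numFieldType) (F : I -> K) (D : K) :
  has_sum F D <-> forall e : K, 0 < e -> exists A : {fset I},
    forall B : {fset I}, (A `<=` B)%fset -> `|D - \sum_(i <- B) F i| <= e.
Proof.
split => [/cvgrPdist_le h e /h|h].
  by case=> A _ hA; exists A => B AB; rewrite -partial_sumE; exact: hA.
apply/cvgrPdist_le => e /h [A hA]; exists A => // B AB; rewrite partial_sumE; exact: hA.
Qed.

Lemma has_sumD (I : choiceType) (K : numFieldType) (F G : I -> K) (D E : K) :
  has_sum F D -> has_sum G E -> has_sum (fun i => F i + G i) (D + E).
Proof.
rewrite /has_sum => hF hG.
have -> : partial_sum (fun i => F i + G i) =
          (fun A => partial_sum F A + partial_sum G A).
  by apply/funext => A; rewrite !partial_sumE big_split.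
exact: (cvgD (V := K^o) hF hG).
Qed.

Lemma has_sumZ (I : choiceType) (K : numFieldType) (F : I -> K) (c D : K) :
  has_sum F D -> has_sum (fun i => c * F i) (c * D).
Proof.
rewrite /has_sum => hF.
have -> : partial_sum (fun i => c * F i) = (fun A => c * partial_sum F A).
  by apply/funext => A; rewrite !partial_sumE mulr_sumr.
exact: (cvgZl_tmp (V := K^o) (k := c) hF).
Qed.

Lemma has_sum0 (I : choiceType) (K : numFieldType) : has_sum (fun _ : I => 0 : K) 0.
Proof.
apply/has_sumP => e e0; exists fset0 => B _.
by rewrite big1 // subrr normr0 ltW.
Qed.

(** The sum is the supremum of the finite partial sums, which increase with the index set. *)
Lemma has_sum_nonneg (I : choiceType) (R : realType) (f : I -> R) (C : R) :
  (forall i, 0 <= f i) -> (forall A : {fset I}, \sum_(i <- A) f i <= C) ->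
  exists D, has_sum f D.
Proof.
move=> f0 fC.
pose S := [set z | exists A : {fset I}, z = \sum_(i <- A) f i]%classic.
have supS : has_sup S.
  by split; [exists (\sum_(i <- fset0) f i), fset0%fset | exists C => _ [A ->]].
exists (sup S); apply/has_sumP => e e0.
have [_ [A ->] hA] := sup_adherent e0 supS.
exists A => B AB.
have hB : \sum_(i <- B) f i <= sup S by apply: sup_upper_bound => //; exists B.
have hAB : \sum_(i <- A) f i <= \sum_(i <- B) f i.
  rewrite [leRHS](big_fsetID _ (mem A)) /=.
  rewrite (_ : \sum_(i <- A) f i = \sum_(i <- [fset x in B | x \in A]%fset) f i).
    by rewrite lerDl sumr_ge0.
  apply: eq_fbigl => i; rewrite !inE /= andbC; case: (boolP (i \in A)) => //= iA.
  by rewrite (fsubsetP AB).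
by rewrite ger0_norm ?subr_ge0 //; lra.
Qed.

(** f is the difference of |f| + f and |f|, both nonnegative with bounded partial sums. *)
Lemma has_sum_real (I : choiceType) (R : realType) (f : I -> R) (C : R) :
  (forall A : {fset I}, \sum_(i <- A) `|f i| <= C) -> exists D, has_sum f D.
Proof.
move=> fC.
have [D1 h1] := has_sum_nonneg (fun i => normr_ge0 (f i)) fC.
have [||D2 h2] := @has_sum_nonneg I R (fun i => `|f i| + f i) (C + C).
- by move=> i; have := lerNnormlW (lexx `|f i|); lra.
- move=> A; rewrite big_split /= lerD // (le_trans _ (fC A)) // ler_sum // => i _.
  exact: ler_norm.
exists (D2 + -1 * D1).
have -> : f = (fun i => (`|f i| + f i) + -1 * `|f i|) by apply/funext => i; ring.
exact: has_sumD h2 (has_sumZ h1).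
Qed.

Lemma cvg_real_complex (R : realType) (T : Type) (F : set_system T) (FF : Filter F)
    (u : T -> R) (l : R) :
  (u @ F --> (l : R^o))%classic ->
  ((fun t => (u t)%:C : (R[i] : numFieldType)^o) @ F
     --> (l%:C : (R[i] : numFieldType)^o))%classic.
Proof.
move=> /cvgrPdist_le h; apply/cvgrPdist_le => e e0.
have eE : e = (complex.Re e)%:C :> R[i] by rewrite RRe_real // gtr0_real.
move: e0; rewrite eE ltcR => /h; apply: filterS => t.
by rewrite -rmorphB /= normc_def /= expr0n addr0 sqrtr_sqr lecR.
Qed.

Lemma has_sum_real_complex (I : choiceType) (R : realType) (f : I -> R) (D : R) :
  has_sum f D -> has_sum (fun i => (f i)%:C) D%:C.
Proof.
move=> /cvg_real_complex; rewrite /has_sum.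
have -> : partial_sum (fun i => (f i)%:C) = (fun A => (partial_sum f A)%:C).
  by apply/funext => A; rewrite !partial_sumE rmorph_sum.
exact.
Qed.

Lemma has_sum_complex (I : choiceType) (R : realType) (F : I -> R[i]) (C : R) :
  (forall A : {fset I}, \sum_(i <- A) `|F i| <= C%:C) -> exists D, has_sum F D.
Proof.
move=> FC.
have hRe (A : {fset I}) : \sum_(i <- A) `|complex.Re (F i)| <= C.
  rewrite -lecR (le_trans _ (FC A)) // rmorph_sum ler_sum // => i _; exact: normc_ge_Re.
have hIm (A : {fset I}) : \sum_(i <- A) `|complex.Im (F i)| <= C.
  rewrite -lecR (le_trans _ (FC A)) // rmorph_sum ler_sum // => i _.
  by case: (F i) => a c; simpc; rewrite -sqrtr_sqr ler_wsqrtr // lerDr sqr_ge0.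
have [D1 /has_sum_real_complex h1] := has_sum_real hRe.
have [D2 /has_sum_real_complex h2] := has_sum_real hIm.
exists (D1%:C + 'i * D2%:C).
have -> : F = (fun i => (complex.Re (F i))%:C + 'i * (complex.Im (F i))%:C).
  by apply/funext => i; exact: complexE.
exact: has_sumD h1 (has_sumZ h2).
Qed.

(** * Finite rectangles and summation by rows *)

Definition box (M N : nat) : {fset nat * nat} :=
  seq_fset tt [seq (m, n) | m <- iota 0 M, n <- iota 0 N].

Lemma in_box (M N : nat) (p : nat * nat) : (p \in box M N) = (p.1 < M)%N && (p.2 < N)%N.
Proof.
rewrite seq_fsetE; apply/allpairsP/idP => [[q [+ + ->]]|/andP[h1 h2]].
  by rewrite !mem_iota /= => -> ->.
by exists p; rewrite !mem_iota /= h1 h2; case: p {h1 h2}.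
Qed.

Lemma big_box (V : nmodType) (F : nat * nat -> V) (M N : nat) :
  \sum_(p <- box M N) F p = \sum_(n < N) \sum_(m < M) F (val m, val n).
Proof.
rewrite (perm_big _ (seq_fset_perm _ _)) /= undup_id; last first.
  by apply: allpairs_uniq; rewrite ?iota_uniq // => -[a c] [a' c'] _ _ /= [-> ->].
rewrite big_allpairs exchange_big /= -!(big_mkord xpredT (fun n => \sum_(m < M) F (val m, n))).
rewrite /index_iota subn0; apply: eq_bigr => n _.
by rewrite -(big_mkord xpredT (fun m => F (m, n))) /index_iota subn0.
Qed.

Lemma sub_box (A : {fset nat * nat}) :
  exists k, forall M N, (k <= M)%N -> (k <= N)%N -> (A `<=` box M N)%fset.
Proof.
exists (\sum_(p <- A) (p.1 + p.2).+1)%N => M N kM kN; apply/fsubsetP => p pA.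
have : ((p.1 + p.2).+1 <= \sum_(p <- A) (p.1 + p.2).+1)%N.
  by rewrite (big_fsetD1 _ pA) /= leq_addr.
rewrite in_box => h; rewrite (leq_trans _ (leq_trans h kM)) ?ltnS ?leq_addr //.
by rewrite (leq_trans _ (leq_trans h kN)) ?ltnS ?leq_addl.
Qed.

Lemma cvg_sum_ord0 (K : numFieldType) (f : nat -> nat -> K) (k : nat) :
  (forall n, f n @ \oo --> (0 : K^o))%classic ->
  ((fun M => \sum_(n < k) f n M) @ \oo --> (0 : K^o))%classic.
Proof.
move=> f0; elim: k => [|k IH].
  under eq_fun do rewrite big_ord0; exact: cvg_cst.
under eq_fun do rewrite big_ord_recr /=.
have := cvgD (V := K^o) IH (f0 k); rewrite addr0 => h. exact: h.
Qed.

Lemma cvg_mul0 (K : numFieldType) (u : nat -> K) (c : K) :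
  (u @ \oo --> (0 : K^o))%classic -> ((fun M => c * u M) @ \oo --> (0 : K^o))%classic.
Proof.
by move=> u0; have := cvgZl_tmp (V := K^o) (k := c) u0; rewrite scaler0; apply.
Qed.

(** Rectangles of a fixed height k and growing width eventually contain any given finite set once k
    is large, so their sums stay within e/2 of D. Such a sum consists of k rows, each tending to 0,
    hence it becomes smaller than e/2. *)
Lemma has_sum_rows0 (K : numFieldType) (F : nat * nat -> K) (D : K) :
  has_sum F D ->
  (forall n, (fun M => \sum_(m < M) F (val m, n)) @ \oo --> (0 : K^o))%classic -> D = 0.
Proof.
move=> /has_sumP hF h0.
have bnd e : 0 < e -> `|D| <= e.
  move=> e0; have [A hA] := hF _ (divr_gt0 e0 (ltr0Sn _ 1)).
  have [k hk] := sub_box A.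
  have : ((fun M => \sum_(n < k) \sum_(m < M) F (val m, val n)) @ \oo --> (0 : K^o))%classic.
    exact: (cvg_sum_ord0 (f := fun n M => \sum_(m < M) F (val m, n))).
  move=> /cvgr0_norm_le /(_ _ (divr_gt0 e0 (ltr0Sn _ 1))) [k' _ hk'].
  have := hA _ (hk (maxn k k') k (leq_maxl _ _) (leqnn _)); rewrite big_box.
  have := hk' (maxn k k') (leq_maxr _ _); rewrite /=.
  move: (\sum_(n < k) _) => S hS hD.
  rewrite -(subrK S D) (le_trans (ler_normD _ _)) // [e in leRHS](splitr e) lerD //.
apply/eqP; rewrite -normr_le0; apply/ler_addgt0Pr => e e0; rewrite add0r; exact: bnd.
Qed.

(** Simple series are encoded as double families supported on m = 0, so that both sides of the
    identity obey the same calculus. *)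
Lemma has_sum_row0 (K : numFieldType) (f : nat -> K) (D : K) :
  has_sum (fun p : nat * nat => if p.1 == 0%N then f p.2 else 0) D ->
  (series f @ \oo --> (D : K^o))%classic.
Proof.
move=> /has_sumP hF; apply/cvgrPdist_le => e /hF [A hA].
have [k hk] := sub_box A; exists k => // N /= kN.
have := hA _ (hk k.+1 N (leqnSn _) kN); rewrite big_box /series /= big_mkord.
by under eq_bigr do rewrite big_ord_recl /= big1 // addr0.
Qed.

(** Reindexing along the injection (m, n) -> (m, m + n), outside whose image G vanishes. It turns
    series in x^(m+n) into series in x^n. *)
Lemma has_sum_shift (K : numFieldType) (F G : nat * nat -> K) (D : K) :
  (forall m n, F (m, n) = G (m, (m + n)%N)) -> (forall m n, (n < m)%N -> G (m, n) = 0) ->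
  has_sum F D -> has_sum G D.
Proof.
move=> FG G0 /has_sumP hF; apply/has_sumP => e /hF [A hA].
exists [fset (p.1, (p.1 + p.2)%N) | p in A]%fset => B AB.
(* The preimage of B under this injection. *)
pose A' := [fset (p.1, (p.2 - p.1)%N) | p in [fset p in B | (p.1 <= p.2)%N]]%fset.
have -> : \sum_(p <- B) G p = \sum_(p <- A') F p.
  rewrite big_imfset /=; last first.
    move=> [m n] [m' n']; rewrite !inE /= => /andP[_ h] /andP[_ h'] [e1 e2]; subst m'.
    by rewrite -(subnK h) e2 subnK.
  rewrite (big_fsetID _ (fun p => p.1 <= p.2)%N) /= [X in _ + X]big1_fset ?addr0.
    rewrite big_seq [RHS]big_seq; apply: eq_bigr => -[m n]; rewrite !inE /= => /andP[_ h].
    by rewrite FG subnKC.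
  by move=> [m n]; rewrite !inE /= -ltnNge => /andP[_ h] _; exact: G0.
apply: hA; apply/fsubsetP => -[m n] pA; apply/imfsetP; exists (m, (m + n)%N) => /=.
  rewrite !inE /= leq_addr andbT; apply: (fsubsetP AB).
  by apply/imfsetP; exists (m, n).
by rewrite addKn.
Qed.

(* The majorants 1/(p q (p+q)) of the double series are at most rho (p-1) rho (q-1)
   because sqrt p * sqrt q <= p + q; the product form bounds all finite sums. *)
Definition rho (R : realType) (n : nat) : R := (n.+1%:R * Num.sqrt n.+1%:R)^-1.

Lemma rho_gt0 (R : realType) (n : nat) : 0 < rho R n.
Proof. by rewrite invr_gt0 mulr_gt0 // sqrtr_gt0. Qed.

(** [rho R n] is (n+1)^(-3/2). Comparison with the integral suggests the sharper bound 3 -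
    2/sqrt(n+1) for n+1 terms, an equality for one term, which is stable under induction. *)
Lemma sum_rho_le (R : realType) (N : nat) : \sum_(n < N) rho R n <= 3.
Proof.
have h n : \sum_(k < n.+1) rho R k <= 3 - 2 / Num.sqrt n.+1%:R.
  elim: n => [|n IH]; first by rewrite big_ord1 /rho /= sqrtr1 mulr1 invr1; lra.
  rewrite big_ord_recr /= (le_trans (lerD IH (lexx _))) //.
  rewrite /rho; set s := Num.sqrt n.+1%:R; set t := Num.sqrt n.+2%:R.
  have s0 : 0 < s by rewrite sqrtr_gt0.
  have st : s <= t by rewrite ler_sqrt // ler_nat.
  have t0 : 0 < t by rewrite (lt_le_trans s0).
  have s2 : s ^+ 2 = n.+1%:R by rewrite sqr_sqrtr.
  have t2 : t ^+ 2 = n.+2%:R by rewrite sqr_sqrtr.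
  have e : t ^+ 2 = s ^+ 2 + 1 by rewrite s2 t2 natr1.
  rewrite -t2 -subr_ge0.
  have -> : 3 - 2 / t - (3 - 2 / s + (t ^+ 2 * t)^-1) =
     (2 * (t - s) * t ^+ 2 - s) / (s * t ^+ 3) by field; rewrite !gt_eqF.
  apply: divr_ge0; last by rewrite mulr_ge0 ?exprn_ge0 ?(ltW s0) ?(ltW t0).
  (* The relation (t - s)(t + s) = 1 makes the expression homogeneous, and it then factors with a
     square. *)
  have -> : 2 * (t - s) * t ^+ 2 - s = (t - s) * (t - s) * (2 * t + s).
    have d : (t - s) * (t + s) = 1.
      by rewrite -subr_sqr e addrC addKr.
    transitivity (2 * (t - s) * t ^+ 2 - s * ((t - s) * (t + s))); last by ring.
    by rewrite d mulr1.
  by rewrite -expr2 mulr_ge0 ?sqr_ge0 // addr_ge0 ?mulr_ge0 ?(ltW s0) ?(ltW t0).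
case: N => [|N]; first by rewrite big_ord0.
by rewrite (le_trans (h N)) // gerBl divr_ge0.
Qed.

(** Every finite set lies in a square box, over which the product majorant factors into two sums
    bounded by 3. *)
Lemma has_sum_rho (R : realType) (F : nat * nat -> R[i]) (C : R) : 0 <= C ->
  (forall m n, `|F (m, n)| <= (C * rho R m * rho R n)%:C) -> exists D, has_sum F D.
Proof.
move=> C0 hF; apply: (@has_sum_complex _ _ _ (C * 3 * 3)) => A.
have [k /(_ k k (leqnn _) (leqnn _)) hA] := sub_box A.
apply: (@le_trans _ _ (\sum_(p <- box k k) `|F p|)).
  rewrite [leRHS](big_fsetID _ (mem A)) /=.
  rewrite [leLHS](_ : _ = \sum_(i <- [fset x in box k k | x \in A]%fset) `|F i|).
    by rewrite lerDl sumr_ge0.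
  apply: eq_fbigl => i; rewrite !inE /= andbC; case: (boolP (i \in A)) => //= iA.
  by rewrite (fsubsetP hA).
rewrite big_box; apply: (@le_trans _ _ (\sum_(n < k) \sum_(m < k) C * rho R m * rho R n)%:C).
  rewrite rmorph_sum ler_sum // => n _; rewrite rmorph_sum ler_sum // => m _; exact: hF.
rewrite lecR; under eq_bigr do rewrite -mulr_suml -mulr_sumr.
rewrite -mulr_sumr ler_pM ?mulr_ge0 ?sumr_ge0 ?ler_wpM2l ?sum_rho_le // => i _;
  exact/ltW/rho_gt0.
Qed.

(* r m n is the contribution of the index m to the coefficient of x^n in D. *)
Definition coeff_sum (R : realType) (x D : R[i]) (r : nat -> nat -> R) : Prop :=
  has_sum (fun p : nat * nat => x ^+ p.2 * (r p.1 p.2)%:C) D.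

(** * Calculus of coefficient families *)

Section CoeffSum.
Variables (R : realType) (x : R[i]).

Lemma coeff_sumD D E r s : coeff_sum x D r -> coeff_sum x E s ->
  coeff_sum x (D + E) (fun m n => r m n + s m n).
Proof.
move=> hr hs; have := has_sumD hr hs; rewrite /coeff_sum.
by under [X in _ -> has_sum X _]eq_fun do rewrite rmorphD mulrDr.
Qed.

Lemma coeff_sumZ D (c : R) r : coeff_sum x D r ->
  coeff_sum x (c%:C * D) (fun m n => c * r m n).
Proof.
move=> hr; have := has_sumZ (c := c%:C) hr; rewrite /coeff_sum.
by under [X in _ -> has_sum X _]eq_fun do rewrite rmorphM mulrCA.
Qed.

Lemma coeff_sumB D E r s : coeff_sum x D r -> coeff_sum x E s ->
  coeff_sum x (D - E) (fun m n => r m n - s m n).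
Proof.
move=> hr /(coeff_sumZ (c := -1)) /(coeff_sumD hr); rewrite rmorphN1 mulN1r.
by under [X in coeff_sum _ _ X -> _]eq_fun do under eq_fun do rewrite mulN1r.
Qed.

Lemma coeff_sum_nat D (k : nat) r : coeff_sum x D r ->
  coeff_sum x (k%:R * D) (fun m n => k%:R * r m n).
Proof. by move=> /(coeff_sumZ (c := k%:R)); rewrite rmorph_nat. Qed.

Lemma coeff_sum_big (a b : nat) (D : nat -> R[i]) r :
  (forall i, (a <= i < b)%N -> coeff_sum x (D i) (r i)) ->
  coeff_sum x (\sum_(a <= i < b) D i) (fun m n => \sum_(a <= i < b) r i m n).
Proof.
elim: b => [|b IH] h.
  rewrite big_geq // /coeff_sum.
  under eq_fun do rewrite big_geq // rmorph0 mulr0; exact: has_sum0.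
have [ab|ab] := leqP a b.
  have hI : coeff_sum x (\sum_(a <= i < b) D i) (fun m n => \sum_(a <= i < b) r i m n).
    by apply: IH => i /andP[h1 h2]; apply: h; rewrite h1 ltnW.
  have hb : coeff_sum x (D b) (r b) by apply: h; rewrite ab ltnSn.
  have -> : (fun m n => \sum_(a <= i < b.+1) r i m n) =
            (fun m n => \sum_(a <= i < b) r i m n + r b m n).
    by apply/funext => m; apply/funext => n; rewrite big_nat_recr.
  have -> : \sum_(a <= i < b.+1) D i = \sum_(a <= i < b) D i + D b.
    by rewrite big_nat_recr.
  exact: coeff_sumD.
rewrite big_geq // /coeff_sum.
under eq_fun do rewrite big_geq // rmorph0 mulr0; exact: has_sum0.
Qed.

Lemma coeff_sum_rows0 D r : coeff_sum x D r ->
  (forall n, (fun M => \sum_(m < M) r m n) @ \oo --> (0 : R))%classic -> D = 0.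
Proof.
move=> hD h0; apply: (has_sum_rows0 hD) => n /=.
rewrite (_ : (fun M => _) = (fun M => x ^+ n * (\sum_(m < M) r m n)%:C)); last first.
  by apply/funext => M; rewrite rmorph_sum mulr_sumr.
exact: cvg_mul0 (cvg_real_complex _ (h0 n)).
Qed.

(** As |x| <= 1, the powers of x do not enlarge the majorant. The family is thus summable and [dsum]
    is its actual sum. *)
Lemma coeff_sum_dsum (P : pred nat) (F : nat -> nat -> R[i]) (r : nat -> nat -> R) (C : R) :
  `|x| <= 1 -> 0 <= C ->
  (forall m n, P m -> F m n = x ^+ n * (r m n)%:C) ->
  (forall m n, P m -> `|r m n| <= C * rho R m * rho R n) ->
  coeff_sum x (dsum P F) (fun m n => if P m then r m n else 0).
Proof.
move=> x1 C0 Fr rC.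
have [||D hD] := @has_sum_rho R (fun p => if P p.1 then F p.1 p.2 else 0) C.
- exact: C0.
- move=> m n /=; case: ifP => Pm; last first.
    by rewrite normr0 ler0c !mulr_ge0 // ltW // rho_gt0.
  rewrite Fr // normrM normrX -[leRHS]mul1r ler_pM ?exprn_ge0 ?exprn_ile1 //.
  by rewrite normc_def /= expr0n addr0 sqrtr_sqr lecR rC.
rewrite /dsum /summability.sum (cvg_lim _ hD) //.
rewrite /coeff_sum [X in has_sum X _](_ : _ = (fun p => if P p.1 then F p.1 p.2 else 0)) //.
by apply/funext => -[m n] /=; case: ifP => Pm; rewrite ?Fr // rmorph0 mulr0.
Qed.

Lemma coeff_sum_dsum_shift (P : pred nat) (F : nat -> nat -> R[i])
    (r : nat -> nat -> R) (C : R) :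
  `|x| <= 1 -> 0 <= C ->
  (forall m n, P m -> F m n = x ^+ (m + n) * (r m n)%:C) ->
  (forall m n, P m -> `|r m n| <= C * rho R m * rho R n) ->
  coeff_sum x (dsum P F) (fun m n => if P m && (m <= n)%N then r m (n - m)%N else 0).
Proof.
move=> x1 C0 Fr rC.
have [||D hD] := @has_sum_rho R (fun p => if P p.1 then F p.1 p.2 else 0) C.
- exact: C0.
- move=> m n /=; case: ifP => Pm; last first.
    by rewrite normr0 ler0c !mulr_ge0 // ltW // rho_gt0.
  rewrite Fr // normrM normrX -[leRHS]mul1r ler_pM ?exprn_ge0 ?exprn_ile1 //.
  by rewrite normc_def /= expr0n addr0 sqrtr_sqr lecR rC.
rewrite /dsum /summability.sum (cvg_lim _ hD) //.
apply: (has_sum_shift _ _ hD) => m n /=.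
  by rewrite leq_addr andbT addKn; case: ifP => Pm; rewrite ?Fr // rmorph0 mulr0.
by rewrite ltnNge => /negbTE ->; rewrite andbF rmorph0 mulr0.
Qed.

(** Since [rho R 0] is 1, the product majorant restricted to m = 0 is [C * rho R n]. *)
Lemma coeff_sum_csum (f : nat -> R[i]) (r : nat -> R) (C : R) :
  `|x| <= 1 -> 0 <= C ->
  (forall n, f n = x ^+ n * (r n)%:C) -> (forall n, `|r n| <= C * rho R n) ->
  coeff_sum x (csum f) (fun m n => if m == 0%N then r n else 0).
Proof.
move=> x1 C0 fr rC.
have [||D hD] := @has_sum_rho R (fun p => if p.1 == 0%N then f p.2 else 0) C.
- exact: C0.
- move=> m n /=; case: eqP => [->|_]; last first.
    by rewrite normr0 ler0c !mulr_ge0 // ltW // rho_gt0.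
  rewrite fr // normrM normrX -[leRHS]mul1r ler_pM ?exprn_ge0 ?exprn_ile1 //.
  by rewrite normc_def /= expr0n addr0 sqrtr_sqr lecR /rho sqrtr1 mulr1 invr1 mulr1 rC.
rewrite /csum (cvg_lim _ (has_sum_row0 hD)) //.
rewrite /coeff_sum [X in has_sum X _](_ : _ = (fun p => if p.1 == 0%N then f p.2 else 0)) //.
by apply/funext => -[m n] /=; case: ifP => _; rewrite ?fr // rmorph0 mulr0.
Qed.

End CoeffSum.

(** * Coefficients of the double series *)

(** Put v = u + a. In the induction the new last term 1/(a v^(k+2)) merges with 1/(u v^(k+2)) by 1/u
    + 1/a = v/(u a), and the rest is the previous case divided by a. *)
Lemma partial_fraction1 (K : fieldType) (a u : K) (k : nat) :
  a != 0 -> u != 0 -> u + a != 0 ->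
  (u * (u + a) ^+ (k + 1))^-1 +
    \sum_(2 <= nu < k.+2) (a ^+ (k + 2 - nu) * (u + a) ^+ nu)^-1
  = (a ^+ (k + 1))^-1 * (u^-1 - (u + a)^-1).
Proof.
move=> a0 u0 v0; elim: k => [|k IH].
  by rewrite big_geq // !expr1; field; rewrite a0 u0 v0.
rewrite big_nat_recr //=.
have -> : \sum_(2 <= nu < k.+2) (a ^+ (k.+1 + 2 - nu) * (u + a) ^+ nu)^-1 =
     a^-1 * \sum_(2 <= nu < k.+2) (a ^+ (k + 2 - nu) * (u + a) ^+ nu)^-1.
  rewrite mulr_sumr; apply: eq_big_nat => nu /andP[_ h].
  by rewrite addSn subSn ?exprS -?mulrA ?invfM //; lia.
rewrite addSn [in RHS]exprS [in RHS]invfM -mulrA -IH.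
have -> : (k.+1 + 2 - k.+2 = 1)%N by lia.
rewrite addn1 addn2 ?addnS ?addn0 !exprS; field.
by rewrite a0 u0 v0 expf_neq0.
Qed.

(** The same induction, with the new term at nu = 1. The powers of v stop at 3, and the missing
    quadratic term is the correction on the right. *)
Lemma partial_fraction2 (K : fieldType) (a u : K) (k : nat) :
  a != 0 -> u != 0 -> u + a != 0 ->
  (u * (u + a) ^+ (k + 2))^-1 +
    \sum_(1 <= nu < k.+1) (a ^+ nu * (u + a) ^+ (k + 3 - nu))^-1
  = (a ^+ (k + 2))^-1 * (u^-1 - (u + a)^-1) - (a ^+ (k + 1))^-1 * ((u + a) ^+ 2)^-1.
Proof.
move=> a0 u0 v0; elim: k => [|k IH].
  by rewrite big_geq // ; field; rewrite a0 u0 v0.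
rewrite big_nat_recl //=.
have -> : \sum_(1 <= nu < k.+1) (a ^+ nu.+1 * (u + a) ^+ (k.+1 + 3 - nu.+1))^-1 =
     a^-1 * \sum_(1 <= nu < k.+1) (a ^+ nu * (u + a) ^+ (k + 3 - nu))^-1.
  rewrite mulr_sumr; apply: eq_big_nat => nu /andP[_ h].
  by rewrite addSn subSS exprS -mulrA invfM.
have -> : (a ^+ (k.+1 + 2))^-1 = a^-1 * (a ^+ (k + 2))^-1 by rewrite addSn exprS invfM.
have -> : (a ^+ (k.+1 + 1))^-1 = a^-1 * (a ^+ (k + 1))^-1 by rewrite addSn exprS invfM.
rewrite -(mulrA a^-1) -(mulrA a^-1) -mulrBr -IH.
have -> : (k.+1 + 3 - 1 = k.+3)%N by lia.
rewrite !addn2 !exprS; field.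
by rewrite a0 u0 v0 expf_neq0.
Qed.

(** The identity is minus the u-derivative of [partial_fraction1], less [partial_fraction2]. The
    weights nu and the factor k come from differentiating powers of v. *)
Lemma partial_fraction3 (K : fieldType) (a u : K) (k : nat) :
  a != 0 -> u != 0 -> u + a != 0 ->
  (u ^+ 2 * (u + a) ^+ (k + 1))^-1 + k%:R * (u * (u + a) ^+ (k + 2))^-1 +
    \sum_(1 <= nu < k.+1) nu%:R * (a ^+ (k + 1 - nu) * (u + a) ^+ (nu + 2))^-1
  = (a ^+ (k + 1))^-1 * (u ^+ 2)^-1 - (a ^+ (k + 2))^-1 * (u^-1 - (u + a)^-1).
Proof.
move=> a0 u0 v0; elim: k => [|k IH].
  by rewrite big_geq // ; field; rewrite a0 u0 v0.
rewrite big_nat_recr //=.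
have -> : \sum_(1 <= nu < k.+1) nu%:R * (a ^+ (k.+1 + 1 - nu) * (u + a) ^+ (nu + 2))^-1 =
     a^-1 * \sum_(1 <= nu < k.+1) nu%:R * (a ^+ (k + 1 - nu) * (u + a) ^+ (nu + 2))^-1.
  rewrite mulr_sumr; apply: eq_big_nat => nu /andP[_ h].
  have -> : (k.+1 + 1 - nu = (k + 1 - nu).+1)%N by lia.
  by rewrite exprS -mulrA invfM mulrCA.
have -> : (a ^+ (k.+1 + 2))^-1 = a^-1 * (a ^+ (k + 2))^-1 by rewrite addSn exprS invfM.
have -> : (a ^+ (k.+1 + 1))^-1 = a^-1 * (a ^+ (k + 1))^-1 by rewrite addSn exprS invfM.
rewrite -(mulrA a^-1) -(mulrA a^-1) -mulrBr -IH.
have -> : (k.+1 + 1 - k.+1 = 1)%N by lia.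
rewrite !addn2 !addn1 !exprS -natr1; field.
by rewrite a0 u0 v0 expf_neq0.
Qed.

(** With p = m+1 and q = n+1, the denominator is at least c^(i+j) times p (p+q)^2 or q (p+q)^2.
    Either dominates p q sqrt(p q), because p, q and sqrt(p q) are at most p + q. *)
Lemma inv_le_rho (R : realType) (c w z : R) (m n i j : nat) : 0 < c -> c <= 1 ->
  (c * m.+1%:R <= w) || (c * n.+1%:R <= w) -> c * (m.+1%:R + n.+1%:R) <= z ->
  (0 < i)%N -> (1 < j)%N ->
  `|(w ^+ i * z ^+ j)^-1| <= (c ^+ (i + j))^-1 * rho R m * rho R n.
Proof.
move=> c0 c1; rewrite /rho; set p := m.+1%:R; set q := n.+1%:R.
set s := Num.sqrt p; set t := Num.sqrt q.
have p1 : 1 <= p by rewrite ler1n.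
have q1 : 1 <= q by rewrite ler1n.
have s2 : s ^+ 2 = p by rewrite sqr_sqrtr // (le_trans ler01).
have t2 : t ^+ 2 = q by rewrite sqr_sqrtr // (le_trans ler01).
have s0 : 0 < s by rewrite sqrtr_gt0 (lt_le_trans ltr01).
have t0 : 0 < t by rewrite sqrtr_gt0 (lt_le_trans ltr01).
have amgm : s * t <= p + q.
  rewrite -s2 -t2; have := sqr_ge0 (s - t); rewrite sqrrB.
  by have := mulr_gt0 s0 t0; lra.
(* For v >= 1 a power of v is at least v, so every positive exponent is covered by the first
   power. *)
have step (v y : R) (l : nat) : (0 < l)%N -> 1 <= v -> c * v <= y -> c ^+ l * v <= y ^+ l.
  case: l => // l _ v1 vy.
  have cv0 : 0 <= c * v by rewrite mulr_ge0 // ?(ltW c0) // (le_trans ler01).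
  have : (c * v) ^+ l.+1 <= y ^+ l.+1 by rewrite lerXn2r ?nnegrE // (le_trans cv0).
  apply: le_trans; rewrite exprMn ler_pM2l ?exprn_gt0 // exprS ler_peMr ?(le_trans ler01 v1) //.
  exact: exprn_ege1.
move=> hw hz i0 j1.
have z0 : 0 <= z by apply: le_trans hz; rewrite mulr_ge0 ?(ltW c0) // addr_ge0 // (le_trans ler01).
have hzj : c ^+ j * (p + q) ^+ 2 <= z ^+ j.
  case: j j1 => [|[|j]] // _; have pq1 : 1 <= p + q by lra.
  have cv0 : 0 <= c * (p + q) by rewrite mulr_ge0 ?(ltW c0) // (le_trans ler01).
  have : (c * (p + q)) ^+ j.+2 <= z ^+ j.+2 by rewrite lerXn2r ?nnegrE.
  apply: le_trans; rewrite exprMn ler_pM2l ?exprn_gt0 // ler_weXn2l //.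
have main : c ^+ (i + j) * (p * s * (q * t)) <= w ^+ i * z ^+ j.
  have pq0 : 0 < p + q by lra.
  rewrite exprD; case/orP: hw => hw.
    have := step _ _ _ i0 p1 hw => hwi.
    apply: (@le_trans _ _ ((c ^+ i * p) * (c ^+ j * (p + q) ^+ 2))); last first.
      by rewrite ler_pM // ?mulr_ge0 ?exprn_ge0 ?(ltW c0) ?(ltW pq0) // (le_trans ler01).
    rewrite [leRHS](_ : _ = c ^+ i * c ^+ j * (p * (p + q) ^+ 2)); last by ring.
    rewrite ler_pM2l ?mulr_gt0 ?exprn_gt0 // -!mulrA ler_pM2l ?(lt_le_trans ltr01) //.
    rewrite mulrCA expr2 ler_pM ?mulr_ge0 ?(ltW s0) ?(ltW t0) //; lra.
  have := step _ _ _ i0 q1 hw => hwi.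
  apply: (@le_trans _ _ ((c ^+ i * q) * (c ^+ j * (p + q) ^+ 2))); last first.
    by rewrite ler_pM // ?mulr_ge0 ?exprn_ge0 ?(ltW c0) ?(ltW pq0) // (le_trans ler01).
  rewrite [leRHS](_ : _ = c ^+ i * c ^+ j * (q * (p + q) ^+ 2)); last by ring.
  rewrite ler_pM2l ?mulr_gt0 ?exprn_gt0 // [leLHS]mulrCA ler_pM2l ?(lt_le_trans ltr01) //.
  rewrite -mulrA expr2 ler_pM ?mulr_ge0 ?(ltW s0) ?(ltW t0) //; lra.
have P0 : 0 < c ^+ (i + j) * (p * s * (q * t)).
  by rewrite !mulr_gt0 ?exprn_gt0 // (lt_le_trans ltr01).
rewrite ger0_norm; last by rewrite invr_ge0 (le_trans _ main) // ltW.
by rewrite -mulrA -!invfM lef_pV2 ?posrE // (lt_le_trans P0).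
Qed.

(** * Row sums and their limits *)

Lemma sum_shift (V : zmodType) (f : nat -> V) (d M : nat) :
  \sum_(k < M) f (k + d)%N = \sum_(k < M + d) f k - \sum_(k < d) f k.
Proof.
elim: M => [|M IH]; first by rewrite big_ord0 subrr.
by rewrite big_ord_recr /= IH addSn big_ord_recr /= addrAC.
Qed.

Lemma sum_reindex_rev (V : zmodType) (f g : nat -> V) (n : nat) :
  (forall m, (m < n)%N -> g m = f (n - m.+1)%N) -> \sum_(m < n) g m = \sum_(m < n) f m.
Proof.
move=> gf; rewrite (reindex_inj rev_ord_inj) /=; apply: eq_bigr => m _.
by rewrite gf; [congr f; have := ltn_ord m; lia | have := ltn_ord m; lia].
Qed.

Lemma sum_trunc (V : nmodType) (f : nat -> V) (n M : nat) : (n <= M)%N ->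
  \sum_(m < M) (if (m < n)%N then f m else 0) = \sum_(m < n) f m.
Proof. by move=> nM; rewrite (big_ord_widen M f nM) [RHS]big_mkcond. Qed.

Lemma cvg_eventually_eq (R : realType) (u v : nat -> R) (l : R) (N : nat) :
  (forall M, (N <= M)%N -> u M = v M) -> (u @ \oo --> l)%classic -> (v @ \oo --> l)%classic.
Proof.
move=> uv; apply: cvg_trans; apply: (@near_eq_cvg _ _ _ _ u v).
by exists N => // M; exact: uv.
Qed.

(** The difference consists of d consecutive terms of a null sequence. This handles telescoping rows
    whose separate sums diverge. *)
Lemma cvg_shift_diff (R : realType) (f : nat -> R) (d : nat) :
  (f @ \oo --> (0 : R))%classic ->
  ((fun M => \sum_(k < M + d) f k - \sum_(k < M) f k) @ \oo --> (0 : R))%classic.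
Proof.
move=> f0; elim: d => [|d IH].
  rewrite (_ : (fun M => _) = (fun=> 0)); first exact: cvg_cst.
  by apply/funext => M; rewrite addn0 subrr.
rewrite (_ : (fun M => _) = (fun M => \sum_(k < M + d) f k - \sum_(k < M) f k + f (M + d)%N)).
  have fd : ((fun M => f (M + d)%N) @ \oo --> (0 : R))%classic by rewrite cvg_shiftn.
  by have := cvgD IH fd; rewrite addr0; apply.
by apply/funext => M; rewrite addnS big_ord_recr /= addrAC.
Qed.

Lemma cvg_invnD (R : realType) (b : R) (i : nat) : 0 <= b -> (0 < i)%N ->
  ((fun k => ((k%:R + b) ^+ i)^-1) @ \oo --> (0 : R))%classic.
Proof.
move=> b0 i0; apply: (@cvg_of_rate _ _ _ 1) => M; rewrite sub0r normrN mul1r.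
rewrite ger0_norm ?invr_ge0 ?exprn_ge0 ?addr_ge0 // lef_pV2 ?posrE ?exprn_gt0 ?ltr_wpDr //.
case: i i0 => // i _; rewrite exprS -[leLHS]mulr1 ler_pM ?lerDl //.
by rewrite exprn_ege1 // -[leLHS]addr0 lerD // ler1n.
Qed.

(** What the cosine brace leaves at index m after division by 1/(n+b)^(k+1): the terms 1/u - 1/v for
    u = m and u = m - b, then the series in x^(m+n) reindexed to x^n. *)
Definition cot_row (R : realType) (b : R) (m n : nat) : R :=
  (if (0 < m)%N then m%:R^-1 - (m%:R + n%:R + b)^-1 else 0)
  + (if b < m%:R then (m%:R - b)^-1 - (m%:R + n%:R)^-1 else 0)
  - (if (0 < m <= n)%N then m%:R^-1 + ((n - m)%:R + b)^-1 else 0).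

Definition csc2_row (R : realType) (b : R) (m n : nat) : R :=
  (if (0 < m)%N then ((m%:R + n%:R + b) ^+ 2)^-1 else 0)
  + (if b < m%:R then ((m%:R - b) ^+ 2)^-1 else 0)
  + (if (0 < m <= n)%N then (((n - m)%:R + b) ^+ 2)^-1 else 0).

(* d accounts for the index m = 1 when b = 1: it is excluded by b < m, whereas the
   uniform summand does not vanish there, as 0^-1 = 0. *)
Lemma sum_cot_row_cvg (R : realType) (b T d : R) (n : nat) : 0 < b ->
  ((fun M => \sum_(k < M) ((k%:R + b)^-1 - (k%:R + 1 - b)^-1)) @ \oo --> T)%classic ->
  (forall M, (0 < M)%N ->
    \sum_(k < M) (if b < k.+1%:R then (k.+1%:R - b)^-1 - (k.+1%:R + n%:R)^-1 else 0) =
    \sum_(k < M) ((k.+1%:R - b)^-1 - (k.+1%:R + n%:R)^-1) + d) ->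
  ((fun M => \sum_(m < M) cot_row b m n) @ \oo --> (n%:R + b)^-1 - T + d)%classic.
Proof.
move=> b0 cT hd; rewrite -cvg_shiftS /=.
pose h k : R := ((k%:R + 1) ^+ 1)^-1; pose q k : R := ((k%:R + b) ^+ 1)^-1.
have ch := cvg_shift_diff n (@cvg_invnD R 1 1 ler01 (ltn0Sn 0) : (h @ \oo --> (0 : R))%classic).
have cq := cvg_shift_diff n.+1 (cvg_invnD (ltW b0) (ltn0Sn 0) : (q @ \oo --> (0 : R))%classic).
have {cT} lim := cvgD (cvgB (cvgB (cvgB (cvg_cst (n%:R + b)^-1) cT) ch) cq) (cvg_cst d).
rewrite !subr0 in lim.
(* For M > n the part with m <= n is complete. Its finite sums of [h] and [q] cancel those left by
   the two shifted sums, except for the single term [q n]. *)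
refine (cvg_eventually_eq (N := n.+1) _ (lim _ _ _ _ _ _)) => M nM; rewrite !fctE.
rewrite big_ord_recl /= {1}/cot_row /= ltNge (ltW b0) /= addr0 subr0 add0r.
rewrite /cot_row /bump /=.
under [in RHS]eq_bigr => k _ do rewrite add1n /=.
rewrite [RHS]sumrB [in RHS]big_split /= hd ?(leq_trans _ nM) //.
have -> : \sum_(k < M) (if (k < n)%N then k.+1%:R^-1 + ((n - k.+1)%:R + b)^-1 else 0) =
   \sum_(k < n) h k + \sum_(k < n) q k.
  rewrite (sum_trunc (fun k => k.+1%:R^-1 + ((n - k.+1)%:R + b)^-1) (ltnW nM)) big_split /=.
  congr (_ + _); first by apply: eq_bigr => k _; rewrite /h expr1 natr1.
  apply: (sum_reindex_rev (f := q) (g := fun m => ((n - m.+1)%:R + b)^-1)) => k _.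
  by rewrite /q expr1.
have -> : \sum_(k < M) (k.+1%:R^-1 - (k.+1%:R + n%:R + b)^-1) =
   \sum_(k < M) h k - (\sum_(k < M + n.+1) q k - \sum_(k < n.+1) q k).
  rewrite -sum_shift sumrB; congr (_ - _); apply: eq_bigr => k _.
    by rewrite /h expr1 natr1.
  by rewrite /q expr1 -addSnnS natrD.
have -> : \sum_(k < M) ((k.+1%:R - b)^-1 - (k.+1%:R + n%:R)^-1) =
   \sum_(k < M) (k%:R + 1 - b)^-1 - (\sum_(k < M + n) h k - \sum_(k < n) h k).
  rewrite -sum_shift sumrB; congr (_ - _); apply: eq_bigr => k _.
    by rewrite natr1.
  by rewrite /h expr1 natrD addrAC natr1.
have <- : q n = (n%:R + b)^-1 by rewrite /q expr1.
rewrite [in LHS]sumrB (big_ord_recr n) /=.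
have -> : \sum_(k < M) (k%:R + b)^-1 = \sum_(k < M) q k.
  by apply: eq_bigr => k _; rewrite /q expr1.
ring.
Qed.

(** The indices above n come from the shifted squares and those below n from the reindexed series,
    so the expansion of T is complete up to the term of index n. *)
Lemma sum_csc2_row_cvg (R : realType) (b T : R) (n : nat) : 0 < b -> b < 1 ->
  ((fun M => \sum_(k < M) (((k%:R + b) ^+ 2)^-1 + ((k%:R + 1 - b) ^+ 2)^-1)) @ \oo --> T)%classic ->
  ((fun M => \sum_(m < M) csc2_row b m n) @ \oo --> T - ((n%:R + b) ^+ 2)^-1)%classic.
Proof.
move=> b0 b1 cT; rewrite -cvg_shiftS /=.
pose q k : R := ((k%:R + b) ^+ 2)^-1.
have cq := cvg_shift_diff n.+1 (cvg_invnD (ltW b0) (ltn0Sn 1) : (q @ \oo --> (0 : R))%classic).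
have lim := cvgB (cvgD cT cq) (cvg_cst ((n%:R + b) ^+ 2)^-1).
rewrite !addr0 in lim.
refine (cvg_eventually_eq (N := n) _ (lim _ _ _)) => M nM; rewrite !fctE.
rewrite big_ord_recl /= {1}/csc2_row /= ltNge (ltW b0) /= !addr0 add0r.
rewrite /csc2_row /bump /=.
under [in RHS]eq_bigr => k _.
  rewrite add1n /= (lt_le_trans b1) ?ler1n //.
  over.
rewrite [RHS]big_split [in RHS]big_split /=.
have -> : \sum_(k < M) (if (k < n)%N then (((n - k.+1)%:R + b) ^+ 2)^-1 else 0) =
   \sum_(k < n) q k.
  rewrite (sum_trunc (fun k => (((n - k.+1)%:R + b) ^+ 2)^-1) nM).
  exact: (sum_reindex_rev (f := q) (g := fun m => (((n - m.+1)%:R + b) ^+ 2)^-1)).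
have -> : \sum_(k < M) ((k.+1%:R + n%:R + b) ^+ 2)^-1 =
   \sum_(k < M + n.+1) q k - \sum_(k < n.+1) q k.
  rewrite -sum_shift; apply: eq_bigr => k _.
  by rewrite /q -addSnnS natrD.
have -> : \sum_(k < M) ((k.+1%:R - b) ^+ 2)^-1 = \sum_(k < M) ((k%:R + 1 - b) ^+ 2)^-1.
  by apply: eq_bigr => k _; rewrite natr1.
rewrite [in LHS]big_split /= (big_ord_recr n) /= -/(q n).
ring.
Qed.

(** This and [csc2_coeff] follow the two braces of the theorem term by term, so that the rules for
    [coeff_sum] apply literally. In the series in x^(m+n), n becomes n - m under the condition m <=
    n. *)
Definition cot_coeff (R : realType) (b : R) (k m n : nat) : R :=
  (if (1 <= m)%N then (m%:R * (m%:R + n%:R + b) ^+ (k + 1))^-1 else 0)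
  - (if (1 <= m)%N && (m <= n)%N
     then (m%:R * (m%:R + (n - m)%:R + b) ^+ (k + 1))^-1 else 0)
  + \sum_(2 <= nu < k.+2) (if (1 <= m)%N
     then ((n%:R + b) ^+ (k + 2 - nu) * (m%:R + n%:R + b) ^+ nu)^-1 else 0)
  - (if (1 <= m)%N && (m <= n)%N
     then (((n - m)%:R + b) * (m%:R + (n - m)%:R + b) ^+ (k + 1))^-1 else 0)
  + (if b < m%:R then ((m%:R - b) * (m%:R + n%:R) ^+ (k + 1))^-1 else 0)
  + \sum_(2 <= nu < k.+2) (if b < m%:R
     then ((n%:R + b) ^+ (k + 2 - nu) * (m%:R + n%:R) ^+ nu)^-1 else 0).

Definition csc2_coeff (R : realType) (b : R) (k m n : nat) : R :=
  (if (1 <= m)%N then (m%:R * (m%:R + n%:R + b) ^+ (k + 2))^-1 else 0)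
  - (if (1 <= m)%N && (m <= n)%N
     then (m%:R * (m%:R + (n - m)%:R + b) ^+ (k + 2))^-1 else 0)
  + \sum_(1 <= nu < k.+1) (if (1 <= m)%N
     then ((n%:R + b) ^+ nu * (m%:R + n%:R + b) ^+ (k + 3 - nu))^-1 else 0)
  - (if (1 <= m)%N && (m <= n)%N
     then (((n - m)%:R + b) * (m%:R + (n - m)%:R + b) ^+ (k + 2))^-1 else 0)
  - (if (1 <= m)%N && (m <= n)%N
     then (((n - m)%:R + b) ^+ 2 * (m%:R + (n - m)%:R + b) ^+ (k + 1))^-1 else 0)
  - (if b < m%:R then ((m%:R - b) ^+ 2 * (m%:R + n%:R) ^+ (k + 1))^-1 else 0)
  - k%:R * (if b < m%:R then ((m%:R - b) * (m%:R + n%:R) ^+ (k + 2))^-1 else 0)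
  - \sum_(1 <= nu < k.+1) nu%:R * (if b < m%:R
     then ((n%:R + b) ^+ (k + 1 - nu) * (m%:R + n%:R) ^+ (nu + 2))^-1 else 0).

(** [partial_fraction1] is applied with a = n + b, to u = m and to u = m - b. In the reindexed
    series m + (n - m) + b = a, which yields the same power of a. *)
Lemma cot_coeffE (R : realType) (b : R) (k m n : nat) : 0 < b ->
  cot_coeff b k m n = ((n%:R + b) ^+ (k + 1))^-1 * cot_row b m n.
Proof.
move=> b0; have a0 : n%:R + b != 0 :> R by rewrite gt_eqF // ltr_wpDl.
have h1 : (1 <= m)%N ->
    (m%:R * (m%:R + n%:R + b) ^+ (k + 1))^-1 + \sum_(2 <= nu < k.+2)
      ((n%:R + b) ^+ (k + 2 - nu) * (m%:R + n%:R + b) ^+ nu)^-1 =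
    ((n%:R + b) ^+ (k + 1))^-1 * (m%:R^-1 - (m%:R + n%:R + b)^-1).
  move=> m0; rewrite -addrA; apply: partial_fraction1 => //.
    by rewrite pnatr_eq0 -lt0n.
  by rewrite gt_eqF // !ltr_wpDl.
have h2 : b < m%:R ->
    ((m%:R - b) * (m%:R + n%:R) ^+ (k + 1))^-1 + \sum_(2 <= nu < k.+2)
      ((n%:R + b) ^+ (k + 2 - nu) * (m%:R + n%:R) ^+ nu)^-1 =
    ((n%:R + b) ^+ (k + 1))^-1 * ((m%:R - b)^-1 - (m%:R + n%:R)^-1).
  move=> bm; have e : m%:R + n%:R = m%:R - b + (n%:R + b) :> R by ring.
  rewrite e; apply: partial_fraction1 => //; first by rewrite subr_eq0 gt_eqF.
  by rewrite -e gt_eqF // ltr_wpDr // (lt_trans b0).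
have h3 : (1 <= m)%N && (m <= n)%N -> m%:R + (n - m)%:R + b = n%:R + b :> R.
  by move=> /andP[_ mn]; rewrite -natrD subnKC.
rewrite /cot_coeff /cot_row.
move: h1 h2 h3; case: (1 <= m)%N; case: (b < m%:R); case: (m <= n)%N => /= h1 h2 h3;
  rewrite ?(h3 isT) ?big1_eq.
- rewrite mulrBr mulrDr -(h1 isT) -(h2 isT) !invfM; ring.
- rewrite mulrBr mulrDr -(h1 isT) -(h2 isT); ring.
- rewrite mulrBr mulrDr -(h1 isT) !invfM; ring.
- rewrite mulrBr mulrDr -(h1 isT); ring.
- rewrite mulrBr mulrDr -(h2 isT); ring.
- rewrite mulrBr mulrDr -(h2 isT); ring.
- ring.
- ring.
Qed.

(** Here u = m is treated by [partial_fraction2] and u = m - b by [partial_fraction3]; the latter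
    enters with a minus sign, which gives 1/u - 1/v the sign it has in [cot_row]. *)
Lemma csc2_coeffE (R : realType) (b : R) (k m n : nat) : 0 < b ->
  csc2_coeff b k m n = ((n%:R + b) ^+ (k + 2))^-1 * cot_row b m n
                     - ((n%:R + b) ^+ (k + 1))^-1 * csc2_row b m n.
Proof.
move=> b0; have a0 : n%:R + b != 0 :> R by rewrite gt_eqF // ltr_wpDl.
have h1 : (1 <= m)%N ->
    (m%:R * (m%:R + n%:R + b) ^+ (k + 2))^-1 + \sum_(1 <= nu < k.+1)
      ((n%:R + b) ^+ nu * (m%:R + n%:R + b) ^+ (k + 3 - nu))^-1 =
    ((n%:R + b) ^+ (k + 2))^-1 * (m%:R^-1 - (m%:R + n%:R + b)^-1)
    - ((n%:R + b) ^+ (k + 1))^-1 * ((m%:R + n%:R + b) ^+ 2)^-1.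
  move=> m0; rewrite -addrA; apply: partial_fraction2 => //.
    by rewrite pnatr_eq0 -lt0n.
  by rewrite gt_eqF // !ltr_wpDl.
have h2 : b < m%:R ->
    ((m%:R - b) ^+ 2 * (m%:R + n%:R) ^+ (k + 1))^-1 +
    k%:R * ((m%:R - b) * (m%:R + n%:R) ^+ (k + 2))^-1 + \sum_(1 <= nu < k.+1)
      nu%:R * ((n%:R + b) ^+ (k + 1 - nu) * (m%:R + n%:R) ^+ (nu + 2))^-1 =
    ((n%:R + b) ^+ (k + 1))^-1 * ((m%:R - b) ^+ 2)^-1
    - ((n%:R + b) ^+ (k + 2))^-1 * ((m%:R - b)^-1 - (m%:R + n%:R)^-1).
  move=> bm; have e : m%:R + n%:R = m%:R - b + (n%:R + b) :> R by ring.
  rewrite e; apply: partial_fraction3 => //; first by rewrite subr_eq0 gt_eqF.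
  by rewrite -e gt_eqF // ltr_wpDr // (lt_trans b0).
have h3 : (1 <= m)%N && (m <= n)%N -> m%:R + (n - m)%:R + b = n%:R + b :> R.
  by move=> /andP[_ mn]; rewrite -natrD subnKC.
rewrite /csc2_coeff /cot_row /csc2_row.
have h0 : \sum_(1 <= nu < k.+1) nu%:R * 0 = 0 :> R by rewrite big1 // => nu _; rewrite mulr0.
move: h1 h2 h3; case: (1 <= m)%N; case: (b < m%:R); case: (m <= n)%N => /= h1 h2 h3;
  rewrite ?(h3 isT) ?big1_eq ?h0 ?mulr0.
- have := h1 isT; have := h2 isT; rewrite !invfM; lra.
- have := h1 isT; have := h2 isT; lra.
- have := h1 isT; rewrite !invfM; lra.
- have := h1 isT; lra.
- have := h2 isT; lra.
- have := h2 isT; lra.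
- lra.
- lra.
Qed.

Lemma sum_head (V : nmodType) (c : V) (M : nat) : (0 < M)%N ->
  \sum_(m < M) (if val m == 0%N then c else 0) = c.
Proof. by case: M => // M _; rewrite big_ord_recl /= big1 ?addr0. Qed.

(** The right-hand side is placed at m = 0, so that the difference of both sides of the theorem is a
    single double sum. *)
Definition defect_coeff (R : realType) (b : R) (k m n : nat) : R :=
  cos (b * pi) * cot_coeff b k m n - sin (b * pi) / pi * csc2_coeff b k m n
  - (pi * sin (b * pi) * (if m == 0%N then ((n%:R + b) ^+ (k + 1))^-1 else 0)
     + 2 * cos (b * pi) * (if m == 0%N then ((n%:R + b) ^+ (k + 2))^-1 else 0)
     - 2 * sin (b * pi) / pi * (if m == 0%N then ((n%:R + b) ^+ (k + 3))^-1 else 0)).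

Lemma sum_defect_coeff_cvg0 (R : realType) (b : R) (k n : nat) : 0 < b -> b <= 1 ->
  ((fun M => \sum_(m < M) defect_coeff b k m n) @ \oo --> (0 : R))%classic.
Proof.
move=> b0 b1; have pi0 := pi_gt0 R.
have a0 : n%:R + b != 0 :> R by rewrite gt_eqF // ltr_wpDl.
set a := n%:R + b in a0 *; set A := (a ^+ (k + 1))^-1.
have A2 : (a ^+ (k + 2))^-1 = A / a by rewrite /A -invfM -exprSr addnS.
have A3 : (a ^+ (k + 3))^-1 = A / a ^+ 2 by rewrite /A -invfM -exprD -addnA.
pose C M := \sum_(m < M) cot_row b m n; pose S M := \sum_(m < M) csc2_row b m n.
set c := cos (b * pi); set s := sin (b * pi).
pose L := pi * s * A + 2 * c * (A / a) - 2 * s / pi * (A / a ^+ 2).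
have sumE M : (0 < M)%N -> c * A * C M - s / pi * (A / a * C M - A * S M) - L =
  \sum_(m < M) defect_coeff b k m n.
  move=> M0; rewrite /defect_coeff !sumrB !big_split /= -!mulr_sumr !sum_head // A2 A3.
  congr (_ - _).
  under [X in _ = c * X - _]eq_bigr => m _ do rewrite (cot_coeffE _ _ _ b0).
  under [X in _ = _ - _ * X]eq_bigr => m _ do rewrite (csc2_coeffE _ _ _ b0) A2.
  by rewrite sumrB -!mulr_sumr mulrA.
apply: (cvg_eventually_eq (N := 1) sumE).
case: (ltrP b 1) => [b1'|b1'].
  have b01 : 0 < b < 1 by rewrite b0.
  have cC : (C @ \oo --> a^-1 - pi * c / s + 0)%classic.
    apply: sum_cot_row_cvg (cot_series b01) _ => // M _; rewrite addr0.
    by apply: eq_bigr => m _; rewrite (lt_le_trans b1') // ler1n.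
  have cS : (S @ \oo --> (pi / s) ^+ 2 - (a ^+ 2)^-1)%classic.
    exact: sum_csc2_row_cvg (csc2_series b01).
  have s0 : s != 0 by rewrite gt_eqF // sin_gt0_pi // mulr_gt0 //= gtr_pMl.
  have -> : (0 : R) = c * A * (a^-1 - pi * c / s + 0)
     - s / pi * (A / a * (a^-1 - pi * c / s + 0) - A * ((pi / s) ^+ 2 - (a ^+ 2)^-1)) - L.
    have e : c ^+ 2 = 1 - s ^+ 2 by rewrite -(cos2Dsin2 (b * pi)) addrK.
    (* With [pi] generalized to a nonzero p, the combination of limits is a multiple of 1 - s^2 -
       c^2. *)
    have alg (p : R) : p != 0 -> p * A * (1 - s ^+ 2 - c ^+ 2) / s =
        c * A * (a^-1 - p * c / s + 0)
        - s / p * (A / a * (a^-1 - p * c / s + 0) - A * ((p / s) ^+ 2 - (a ^+ 2)^-1))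
        - (p * s * A + 2 * c * (A / a) - 2 * s / p * (A / a ^+ 2)).
      by move=> p0; field; rewrite s0 a0 p0.
    by rewrite /L -alg ?gt_eqF // e subrr mulr0 mul0r.
  apply: cvgB; last exact: cvg_cst.
  apply: cvgB; first exact: cvgMl_tmp.
  by apply: cvgMl_tmp; apply: cvgB; apply: cvgMl_tmp.
have bE : b = 1 by apply/eqP; rewrite eq_le b1.
have s0 : s = 0 by rewrite /s bE mul1r sinpi.
have cC : (C @ \oo --> a^-1 - 0 + a^-1)%classic.
  apply: sum_cot_row_cvg => //.
    (* For b = 1 the differences 1/(k+1) - 1/k telescope to 1/(M+1), where the term 1/k at k = 0 is
       0 by the convention for [0^-1]. *)
    apply: (@cvg_of_rate _ _ _ 1) => M; rewrite sub0r normrN mul1r.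
    rewrite (_ : \sum_(_ < _) _ = M.+1%:R^-1) ?ger0_norm //.
    elim: M => [|M IH]; first by rewrite big_ord1 bE /= add0r subrr invr0 subr0.
    by rewrite big_ord_recr /= IH bE addrK natr1 addrC subrK.
  (* The excluded index m = 1 would have contributed - 1/(n+1), hence the correction [a^-1]. *)
  case=> // M _; rewrite !big_ord_recl /= bE ltxx.
  under eq_bigr => m _ do rewrite /bump /= ltr1n ltnS.
  rewrite subrr invr0 sub0r /a bE (addrC 1); ring.
have -> : (0 : R) = c * A * (a^-1 - 0 + a^-1) - L by rewrite /L s0; ring.
rewrite (_ : (fun M => _) = fun M => c * A * C M - L); last first.
  by apply/funext => M; rewrite s0 !mul0r subr0.
apply: cvgB; [exact: cvgMl_tmp|exact: cvg_cst].
Qed.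

(** * Lower bounds for the denominators and assembly of the identity *)

Lemma linear_lower_bounds (R : realType) (b : R) : 0 < b -> b <= 1 ->
  exists c : R, [/\ 0 < c <= 1,
    forall n, c * n.+1%:R <= n%:R + b,
    forall m, (0 < m)%N -> c * m.+1%:R <= m%:R,
    forall m, b < m%:R -> c * m.+1%:R <= m%:R - b &
    forall m n, (0 < m)%N -> c * (m.+1%:R + n.+1%:R) <= m%:R + n%:R].
Proof.
move=> b0 b1.
have [g [g0 g1 gm]] : exists g : R, [/\ 0 < g, g <= 1 &
    forall m, b < m%:R -> g * m.+1%:R <= m%:R - b].
  have [b1'|b1'] := ltrP b 1.
    (* For m >= 1, m - b >= (1 - b) m >= (1 - b)(m + 1)/2. *)
    exists ((1 - b) / 2); split; [lra|lra|move=> [|m]; first by rewrite ltNge ltW].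
    move=> _; have : 0 <= m%:R :> R by []. rewrite -(natr1 m.+1) -(natr1 m); nra.
  (* For b = 1 the condition forces m >= 2, and m - 1 >= (m + 1)/3 is an equality at m = 2. *)
  exists 3^-1; split; [lra|lra|].
  have -> : b = 1 by apply/eqP; rewrite eq_le b1.
  move=> m; rewrite ltr1n; case: m => [|[|m]] // _.
  have : 0 <= m%:R :> R by []. rewrite -(natr1 m.+2) -(natr1 m.+1) -(natr1 m); lra.
(* This product is below b, g and 1/3 at once; 1/3 is what m + n >= c (m + n + 2) demands at m = 1,
   n = 0. *)
have c0 : 0 < b * g / 3 by rewrite divr_gt0 ?mulr_gt0.
have cb : b * g / 3 <= b by nra.
have cg : b * g / 3 <= g by nra.
have c3 : b * g / 3 <= 3^-1 by nra.
exists (b * g / 3).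
split; [by rewrite c0; nra|move=> n|move=> m m0|move=> m bm|move=> m n m0].
- have n0 : 0 <= n%:R :> R by []. rewrite -(natr1 n) mulrDr mulr1 lerD // ler_piMl //; lra.
- have m1 : 1 <= m%:R :> R by rewrite ler1n. rewrite -(natr1 m); nra.
- by apply: le_trans (gm m bm); rewrite ler_wpM2r.
- have m1 : 1 <= m%:R :> R by rewrite ler1n. have n0 : 0 <= n%:R :> R by [].
  rewrite -(natr1 m) -(natr1 n); nra.
Qed.

Section CoeffSumInverse.
Variables (R : realType) (x : R[i]) (c : R) (P : pred nat).
Variables (w z : nat -> nat -> R) (i j : nat).
Hypotheses (x1 : `|x| <= 1) (c01 : 0 < c <= 1) (i0 : (0 < i)%N) (j1 : (1 < j)%N).
Hypothesis wc : forall m n, P m -> (c * m.+1%:R <= w m n) || (c * n.+1%:R <= w m n).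
Hypothesis zc : forall m n, P m -> c * (m.+1%:R + n.+1%:R) <= z m n.

Let C0 : 0 <= (c ^+ (i + j))^-1.
Proof. by case/andP: c01 => c0 _; rewrite invr_ge0 exprn_ge0 // ltW. Qed.

Let bound m n : P m ->
  `|(w m n ^+ i * z m n ^+ j)^-1| <= (c ^+ (i + j))^-1 * rho R m * rho R n.
Proof.
by case/andP: c01 => c0 c1 Pm; apply: inv_le_rho => //; [exact: wc | exact: zc].
Qed.

Lemma coeff_sum_dsum_inv (F : nat -> nat -> R[i]) :
  (forall m n, P m -> F m n = x ^+ n * ((w m n ^+ i * z m n ^+ j)^-1)%:C) ->
  coeff_sum x (dsum P F) (fun m n => if P m then (w m n ^+ i * z m n ^+ j)^-1 else 0).
Proof. by move=> hF; apply: (coeff_sum_dsum x1 C0) => // m n; exact: bound. Qed.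

Lemma coeff_sum_dsum_shift_inv (F : nat -> nat -> R[i]) :
  (forall m n, P m -> F m n = x ^+ (m + n) * ((w m n ^+ i * z m n ^+ j)^-1)%:C) ->
  coeff_sum x (dsum P F) (fun m n => if P m && (m <= n)%N
    then (w m (n - m)%N ^+ i * z m (n - m)%N ^+ j)^-1 else 0).
Proof.
move=> hF; pose r m n := (w m n ^+ i * z m n ^+ j)^-1.
apply: (coeff_sum_dsum_shift (r := r) x1 C0) => // m n; exact: bound.
Qed.

End CoeffSumInverse.

(** Since b <= 1, n + b >= b (n + 1), and for j >= 2 the power (n + 1)^j dominates (n + 1)^(3/2). *)
Lemma coeff_sum_csum_inv (R : realType) (x : R[i]) (b : R) (j : nat) (f : nat -> R[i]) :
  `|x| <= 1 -> 0 < b -> b <= 1 -> (1 < j)%N ->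
  (forall n, f n = x ^+ n * (((n%:R + b) ^+ j)^-1)%:C) ->
  coeff_sum x (csum f) (fun m n => if m == 0%N then ((n%:R + b) ^+ j)^-1 else 0).
Proof.
move=> x1 b0 b1 j1 hf.
have C0 : 0 <= (b ^+ j)^-1 by rewrite invr_ge0 exprn_ge0 // ltW.
apply: (coeff_sum_csum x1 C0) => // n.
have n1 : 1 <= n.+1%:R :> R by rewrite ler1n.
have n0 : 0 < n.+1%:R :> R by [].
have h : b * n.+1%:R <= n%:R + b.
  have : 0 <= n%:R :> R by []. rewrite -natr1; nra.
rewrite ger0_norm ?invr_ge0 ?exprn_ge0 ?addr_ge0 ?(ltW b0) // /rho -invfM.
have P0 : 0 < b ^+ j * (n.+1%:R * Num.sqrt n.+1%:R).
  by rewrite !mulr_gt0 ?exprn_gt0 ?sqrtr_gt0.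
rewrite lef_pV2 ?posrE ?exprn_gt0 ?ltr_wpDl //.
apply: (@le_trans _ _ ((b * n.+1%:R) ^+ j)); last first.
  by rewrite lerXn2r ?nnegrE ?addr_ge0 ?mulr_ge0 // ltW.
rewrite exprMn ler_pM2l ?exprn_gt0 //.
case: j j1 {P0 C0 hf} => [|[|j]] // _; apply: (@le_trans _ _ (n.+1%:R ^+ 2)).
  rewrite expr2 ler_pM2l // -[leRHS]ger0_norm // -sqrtr_sqr ler_sqrt ?exprn_ge0 //.
  by rewrite expr2 ler_peMr.
by rewrite ler_weXn2l.
Qed.

Theorem theorem1p1 (R : realType) (k : nat) (x : R[i]) (b : R)
    (k_gt0 : (0 < k)%N) (x_le1 : `|x| <= 1) (b_gt0 : 0 < b) (b_le1 : b <= 1) :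
  (cos (b * pi))%:C *
  ( \dsum_(m, n | (1 <= m)%N)
       (x ^+ n / (m%:R * (m%:R + n%:R + b%:C) ^+ (k + 1)))
    - \dsum_(m, n | (1 <= m)%N)
       (x ^+ (m + n) / (m%:R * (m%:R + n%:R + b%:C) ^+ (k + 1)))
    + \sum_(2 <= nu < k.+2) \dsum_(m, n | (1 <= m)%N)
       (x ^+ n / ((n%:R + b%:C) ^+ (k + 2 - nu)
                  * (m%:R + n%:R + b%:C) ^+ nu))
    - \dsum_(m, n | (1 <= m)%N)
       (x ^+ (m + n) / ((n%:R + b%:C) * (m%:R + n%:R + b%:C) ^+ (k + 1)))
    + \dsum_(m, n | b < m%:R)
       (x ^+ n / ((m%:R - b%:C) * (m%:R + n%:R) ^+ (k + 1)))
    + \sum_(2 <= nu < k.+2) \dsum_(m, n | b < m%:R)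
       (x ^+ n / ((n%:R + b%:C) ^+ (k + 2 - nu) * (m%:R + n%:R) ^+ nu)) )
  - (sin (b * pi) / pi)%:C *
  ( \dsum_(m, n | (1 <= m)%N)
       (x ^+ n / (m%:R * (m%:R + n%:R + b%:C) ^+ (k + 2)))
    - \dsum_(m, n | (1 <= m)%N)
       (x ^+ (m + n) / (m%:R * (m%:R + n%:R + b%:C) ^+ (k + 2)))
    + \sum_(1 <= nu < k.+1) \dsum_(m, n | (1 <= m)%N)
       (x ^+ n / ((n%:R + b%:C) ^+ nu
                  * (m%:R + n%:R + b%:C) ^+ (k + 3 - nu)))
    - \dsum_(m, n | (1 <= m)%N)
       (x ^+ (m + n) / ((n%:R + b%:C) * (m%:R + n%:R + b%:C) ^+ (k + 2)))
    - \dsum_(m, n | (1 <= m)%N)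
       (x ^+ (m + n) / ((n%:R + b%:C) ^+ 2 * (m%:R + n%:R + b%:C) ^+ (k + 1)))
    - \dsum_(m, n | b < m%:R)
       (x ^+ n / ((m%:R - b%:C) ^+ 2 * (m%:R + n%:R) ^+ (k + 1)))
    - k%:R * (\dsum_(m, n | b < m%:R)
       (x ^+ n / ((m%:R - b%:C) * (m%:R + n%:R) ^+ (k + 2))))
    - \sum_(1 <= nu < k.+1) nu%:R * (\dsum_(m, n | b < m%:R)
       (x ^+ n / ((n%:R + b%:C) ^+ (k + 1 - nu) * (m%:R + n%:R) ^+ (nu + 2)))) )
  = (pi * sin (b * pi))%:C * (\csum_n (x ^+ n / (n%:R + b%:C) ^+ (k + 1)))
    + (2 * cos (b * pi))%:C * (\csum_n (x ^+ n / (n%:R + b%:C) ^+ (k + 2)))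
    - (2 * sin (b * pi) / pi)%:C * (\csum_n (x ^+ n / (n%:R + b%:C) ^+ (k + 3))).
Proof.
have [c [c01 nb m0 mb mn]] := linear_lower_bounds b_gt0 b_le1.
have mnb m n : (0 < m)%N -> c * (m.+1%:R + n.+1%:R) <= m%:R + n%:R + b.
  by move=> /mn -/(_ n) h; rewrite (le_trans h) // lerDl ltW.
have bmn m n : b < m%:R -> c * (m.+1%:R + n.+1%:R) <= m%:R + n%:R.
  case: m => [h|m _]; last exact: mn.
  by have := lt_trans b_gt0 h; rewrite ltxx.
have rcE := (fmorphV (real_complex R), rmorphM (real_complex R), rmorphXn (real_complex R),
  rmorphB (real_complex R), rmorphD (real_complex R), rmorph_nat (real_complex R)).
(* Three patterns cover all double series: x^n or x^(m+n) over m >= 1 with z = m + n + b, and x^n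
   over m > b with z = m + n. *)
pose sum_m w i j := coeff_sum_dsum_inv (P := fun m => (1 <= m)%N)
  (w := w) (i := i) (j := j) (z := fun m n => m%:R + n%:R + b) x_le1 c01.
pose shift_m w i j := coeff_sum_dsum_shift_inv (P := fun m => (1 <= m)%N)
  (w := w) (i := i) (j := j) (z := fun m n => m%:R + n%:R + b) x_le1 c01.
pose sum_b w i j := coeff_sum_dsum_inv (P := fun m => b < m%:R)
  (w := w) (i := i) (j := j) (z := fun m n => m%:R + n%:R) x_le1 c01.
apply/eqP; rewrite -subr_eq0; apply/eqP.
(* The rows of [defect_coeff] sum to 0; it remains to recognize it as the coefficient family of the
   difference of both sides. *)
apply: (coeff_sum_rows0 (x := x) (r := defect_coeff b k)); last first.
  by move=> n; exact: sum_defect_coeff_cvg0.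
rewrite /defect_coeff; apply: coeff_sumB; [apply: coeff_sumB; apply: coeff_sumZ|].
- rewrite /cot_coeff; apply: coeff_sumD; [apply: coeff_sumD; [apply: coeff_sumB;
    [apply: coeff_sumD; [apply: coeff_sumB|]|]|]|].
  + apply: (sum_m (fun m n => m%:R) 1 (k + 1)%N) => // [|m n Pm|m n Pm]; first lia.
      by rewrite m0.
    by rewrite !rcE.
  + apply: (shift_m (fun m n => m%:R) 1 (k + 1)%N) => // [|m n Pm|m n Pm]; first lia.
      by rewrite m0.
    by rewrite !rcE.
  + apply: coeff_sum_big => nu nuk.
    apply: (sum_m (fun m n => n%:R + b) (k + 2 - nu)%N nu) =>
      // [||m n Pm|m n Pm]; [lia|lia| |].
      by rewrite nb orbT.
    by rewrite !rcE.
  + apply: (shift_m (fun m n => n%:R + b) 1 (k + 1)%N) => // [|m n Pm|m n Pm]; first lia.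
      by rewrite nb orbT.
    by rewrite !rcE.
  + apply: (sum_b (fun m n => m%:R - b) 1 (k + 1)%N) => // [|m n Pm|m n Pm]; first lia.
      by rewrite mb.
    by rewrite !rcE.
  + apply: coeff_sum_big => nu nuk.
    apply: (sum_b (fun m n => n%:R + b) (k + 2 - nu)%N nu) =>
      // [||m n Pm|m n Pm]; [lia|lia| |].
      by rewrite nb orbT.
    by rewrite !rcE.
- rewrite /csc2_coeff; apply: coeff_sumB; [apply: coeff_sumB; [apply: coeff_sumB;
    [apply: coeff_sumB; [apply: coeff_sumB; [apply: coeff_sumD; [apply: coeff_sumB|]|]|]|]|]|].
  + apply: (sum_m (fun m n => m%:R) 1 (k + 2)%N) => // [|m n Pm|m n Pm]; first lia.
      by rewrite m0.
    by rewrite !rcE.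
  + apply: (shift_m (fun m n => m%:R) 1 (k + 2)%N) => // [|m n Pm|m n Pm]; first lia.
      by rewrite m0.
    by rewrite !rcE.
  + apply: coeff_sum_big => nu nuk.
    apply: (sum_m (fun m n => n%:R + b) nu (k + 3 - nu)%N) =>
      // [||m n Pm|m n Pm]; [lia|lia| |].
      by rewrite nb orbT.
    by rewrite !rcE.
  + apply: (shift_m (fun m n => n%:R + b) 1 (k + 2)%N) => // [|m n Pm|m n Pm]; first lia.
      by rewrite nb orbT.
    by rewrite !rcE.
  + apply: (shift_m (fun m n => n%:R + b) 2 (k + 1)%N) => // [|m n Pm|m n Pm]; first lia.
      by rewrite nb orbT.
    by rewrite !rcE.
  + apply: (sum_b (fun m n => m%:R - b) 2 (k + 1)%N) => // [|m n Pm|m n Pm]; first lia.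
      by rewrite mb.
    by rewrite !rcE.
  + apply: coeff_sum_nat.
    apply: (sum_b (fun m n => m%:R - b) 1 (k + 2)%N) => // [|m n Pm|m n Pm]; first lia.
      by rewrite mb.
    by rewrite !rcE.
  + apply: coeff_sum_big => nu nuk; apply: coeff_sum_nat.
    apply: (sum_b (fun m n => n%:R + b) (k + 1 - nu)%N (nu + 2)%N) =>
      // [||m n Pm|m n Pm]; [lia|lia| |].
      by rewrite nb orbT.
    by rewrite !rcE.
- apply: coeff_sumB; [apply: coeff_sumD|]; apply: coeff_sumZ;
    apply: coeff_sum_csum_inv => // [|n]; rewrite ?rcE //; lia.
Qed.
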